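(* Let $\Gamma=(V,E,D,t,o)$ be a mixed graph and let $G_\Gamma$ be the associated twisted right-angled Artin group. Then the following hold. (1) $G_\Gamma$ is torsion-free if and only if $\Gamma$ contains no oriented cycle supported on a complete subgraph. (2) $G_\Gamma$ is left-orderable if and only if $\Gamma$ contains no oriented cycle. (3) $G_\Gamma$ is bi-orderable if and only if $\Gamma$ contains no oriented edge (that is, $D=\emptyset$).
   Context: A mixed graph $\Gamma$ is a quintuple $(V,E,D,t,o)$ where $V$ is a non-empty set (not necessarily finite) whose elements are called vertices; $E\subseteq\{\{x,y\} : x,y\in V,\ x\neq y\}$ is a set of two-element subsets of $V$, called edges; $D\subseteq E$ is a subset whose elements are called oriented edges; and $o,t\colon D\to V$ are functions such that $e=\{o(e),t(e)\}$ for all $e\in D$. An oriented edge $e\in D$ with $o(e)=a$, $t(e)=b$ is denoted $[a,b\rangle$; an edge $\{a,b\}\in E\setminus D$ is denoted $[a,b]$. The twisted right-angled Artin group (TRAAG) based on $\Gamma$ is the group $G_\Gamma$ with generating set $V$ and with one defining relation for each edge: for each $\{a,b\}\in E\setminus D$ the relation $aba^{-1}b^{-1}=1$, and for each $e=[a,b\rangle\in D$ (so $o(e)=a$, $t(e)=b$) the relation $abab^{-1}=1$ (equivalently $bab^{-1}=a^{-1}$). An oriented cycle on $\Gamma$ is a sequence $e_0,\dots,e_n\in D$ such that $t(e_i)=o(e_{i+1})$ for $0\le i<n$ and $t(e_n)=o(e_0)$. The oriented cycle $e_0,\dots,e_n$ is supported on a complete subgraph if for all $x,y\in\bigcup_{i=0}^n\{o(e_i),t(e_i)\}$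 either $x=y$ or $\{x,y\}\in E$. A group $G$ is left-orderable (resp. bi-orderable) if there exists a total order on $G$ that is invariant under left multiplication (resp. under both left and right multiplication). *)

(* Defs.v *)
From HB Require Import structures.
From mathcomp Require Import all_boot.
From mathcomp Require Import boolp classical_sets.

Set Implicit Arguments.
Unset Strict Implicit.
Unset Printing Implicit Defensive.

Local Open Scope classical_set_scope.
Local Open Scope quotient_scope.

(* The functions [o] and [t] are defined on the oriented edges only:
   [oriented] is coerced to the subtype of its members. *)
Record mixedGraph := MixedGraph {
  vertex : Type;
  edge : set (set vertex);
  oriented : set (set vertex);
  org : oriented -> vertex;
  tgt : oriented -> vertex;
  vertex_inhabited : inhabited vertex;
  edge_pair : forall e, edge e ->
    exists x y : vertex, x <> y /\ e = [set x; y];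
  oriented_edge : oriented `<=` edge;
  oriented_ends : forall e : oriented, val e = [set org e; tgt e]
}.

Arguments edge : clear implicits.
Arguments oriented : clear implicits.

Section Presentation.
Variable X : choiceType.

(* A word in the generators and their inverses; the letter [(x, b)] is
   x^-1 if [b] is true, and x otherwise. *)
Definition word := seq (X * bool).

Definition winv (w : word) : word := rev [seq (l.1, ~~ l.2) | l <- w].

Variable R : set word.

(* Equality of words in the group presented by < X | R >. *)
Inductive pres_eq : word -> word -> Prop :=
| PresRefl u : pres_eq u u
| PresSym u v : pres_eq u v -> pres_eq v u
| PresTrans u v w : pres_eq u v -> pres_eq v w -> pres_eq u w
| PresCat u u' v v' :
    pres_eq u u' -> pres_eq v v' -> pres_eq (u ++ v) (u' ++ v')
| PresCancel x b : pres_eq [:: (x, b); (x, ~~ b)] [::]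
| PresRel r : R r -> pres_eq r [::].

Definition pres_rel : rel word := fun u v => `[< pres_eq u v >].

Lemma pres_rel_is_equiv : equiv_class_of pres_rel.
Proof.
split=> [u | u v | v u w].
- exact/asboolP/PresRefl.
- by apply/asboolP/asboolP; apply: PresSym.
- by move=> /asboolP uv /asboolP vw; apply/asboolP; apply: PresTrans uv vw.
Qed.

Canonical pres_equiv := EquivRelPack pres_rel_is_equiv.

Definition presented := {eq_quot pres_equiv}.
HB.instance Definition _ := Choice.on presented.

Lemma presP (u v : word) : pres_eq u v <-> \pi_presented u = \pi_presented v.
Proof.
by split=> [uv | /eqmodP/asboolP //]; apply/eqmodP/asboolP.
Qed.

Lemma pres_repr (u : word) : pres_eq (repr (\pi_presented u)) u.
Proof. by apply/presP; rewrite reprK. Qed.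

Lemma pres_winvr u : pres_eq (u ++ winv u) [::].
Proof.
elim: u => [|[x b] u IHu]; first exact: PresRefl.
rewrite /winv /= rev_cons -cats1 -/(winv u) catA -cat1s.
apply: PresTrans (PresCancel x b); rewrite -[[:: (x, b); _]]cat1s.
apply: PresCat (PresRefl _) _; rewrite -[X in pres_eq _ X]cat0s.
exact: PresCat IHu (PresRefl _).
Qed.

Lemma winvK : involutive winv.
Proof.
move=> u; rewrite /winv map_rev revK -map_comp -[RHS]map_id.
by apply: eq_map => -[x b] /=; rewrite negbK.
Qed.

Lemma pres_winvl u : pres_eq (winv u ++ u) [::].
Proof. by have := pres_winvr (winv u); rewrite winvK. Qed.

Definition pres_one : presented := \pi_presented [::].
Definition pres_mul (g h : presented) : presented := \pi_presented (repr g ++ repr h).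
Definition pres_inv (g : presented) : presented := \pi_presented (winv (repr g)).

Lemma pres_mulA : associative pres_mul.
Proof.
move=> f g h; apply/presP.
apply: (PresTrans (PresCat (PresRefl _) (pres_repr _))); rewrite catA.
exact: PresCat (PresSym (pres_repr _)) (PresRefl _).
Qed.

Lemma pres_mul1 : left_id pres_one pres_mul.
Proof.
move=> g; rewrite -[RHS]reprK; apply/presP.
exact: PresCat (pres_repr _) (PresRefl _).
Qed.

Lemma pres_1mul : right_id pres_one pres_mul.
Proof.
move=> g; rewrite -[RHS]reprK; apply/presP; rewrite -[X in pres_eq _ X]cats0.
exact: PresCat (PresRefl _) (pres_repr _).
Qed.

Lemma pres_mulVg : left_inverse pres_one pres_inv pres_mul.
Proof.
move=> g; apply/presP; apply: PresTrans (pres_winvl (repr g)).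
exact: PresCat (pres_repr _) (PresRefl _).
Qed.

Lemma pres_mulgV : right_inverse pres_one pres_inv pres_mul.
Proof.
move=> g; apply/presP; apply: PresTrans (pres_winvr (repr g)).
exact: PresCat (PresRefl _) (pres_repr _).
Qed.

HB.instance Definition _ := isGroup.Build presented
  pres_mulA pres_mul1 pres_1mul pres_mulVg pres_mulgV.

End Presentation.

Section TRAAG.
Variable G : mixedGraph.

(* An unoriented edge {a, b} contributes both a b a^-1 b^-1 and
   b a b^-1 a^-1; these are inverse to each other in the free group. *)
Definition traag_relators : set (word {classic vertex G}) :=
  [set w | (exists a b : vertex G, (edge G `\` oriented G) [set a; b]
              /\ w = [:: (a, false); (b, false); (a, true); (b, true)])
        \/ (exists e : oriented G,
              w = [:: (org e, false); (tgt e, false); (org e, false);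
                      (tgt e, true)])].

Definition TRAAG : groupType := presented traag_relators.

Definition oriented_cycle n (e : 'I_n.+1 -> oriented G) : Prop :=
  (* [ordS] is the cyclic successor, so this includes t(e_n) = o(e_0). *)
  forall i, tgt (e i) = org (e (ordS i)).

Definition supported_on_complete n (e : 'I_n.+1 -> oriented G) : Prop :=
  let U := \bigcup_i [set org (e i); tgt (e i)] in
  forall x y : vertex G, U x -> U y -> x = y \/ edge G [set x; y].

End TRAAG.

Local Open Scope group_scope.

Definition torsion_free (G : groupType) : Prop :=
  forall (g : G) (n : nat), (0 < n)%N -> g ^+ n = 1 -> g = 1.

Definition total_order (T : Type) (le : rel T) : Prop :=
  [/\ reflexive le, antisymmetric le, transitive le & total le].

Definition left_orderable (G : groupType) : Prop :=
  exists le : rel G, total_order le /\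
    (forall f g h : G, le g h -> le (f * g) (f * h)).

Definition bi_orderable (G : groupType) : Prop :=
  exists le : rel G, [/\ total_order le,
    (forall f g h : G, le g h -> le (f * g) (f * h)) &
    (forall f g h : G, le g h -> le (g * f) (h * f))].

(* Main.v *)
(* Let A be the untwisted right-angled Artin group on the underlying graph.
   Each generator v acts on A by inverting the generators a with an oriented
   edge from a to v, and sending v to (v, this action) embeds the twisted group
   G in the semidirect product of A with the sign changes of the generators;
   the map G -> A so obtained is a crossed homomorphism with trivial kernel.

   A is bi-ordered through the Magnus-type representation v |-> 1 + X_v, in which
   the X_v commute along edges and X_v^2 = 0, so that v^k |-> 1 + k X_v.  It is
   faithful: in a product of r reduced syllables, the part of degree r is the
   single monomial of the underlying word, with a nonzero coefficient.  The order
   is given by the sign of a leading coefficient in the lowest nonzero degree.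

   (1) If g in G has finite order, then g^2 comes from A, hence g^2 = 1, that is
   x e(x) = 1 for the image x of g in A and a sign change e.  The word of x is
   then a palindrome up to commutations; conjugating, its letters may be assumed
   to be pairwise adjacent and all inverted by e, so each of them has an
   out-neighbour among them, which gives an oriented cycle on a clique.
   (2) If there is no oriented cycle, order the vertices linearly along the
   edges, and take the sign of the exponent sum in A of the last vertex for which
   it does not vanish; the elements with zero exponent sums form a subgroup of A,
   which is ordered as above. *)
Require Import Defs.
From mathcomp Require Import all_boot all_order all_algebra.
From mathcomp Require Import boolp classical_sets.
From mathcomp Require Import ring zify.

Set Implicit Arguments.
Unset Strict Implicit.
Unset Printing Implicit Defensive.

Import Order.TTheory GRing.Theory Num.Theory.
Local Open Scope quotient_scope.
Local Open Scope ring_scope.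

(** * Words and cones of positive elements *)

Section Presented.
Variables (X : choiceType) (R : set (word X)).
Local Open Scope group_scope.

Definition wordg (w : word X) : (presented R : groupType) := \pi_(presented R) w.

Lemma wordgP (u w : word X) : pres_eq R u w <-> wordg u = wordg w.
Proof. exact: presP. Qed.

Lemma wordgK (g : presented R) : wordg (repr g) = g.
Proof. exact: reprK. Qed.

Lemma wordg_cat (u w : word X) : wordg (u ++ w) = wordg u * wordg w.
Proof.
by apply/wordgP/PresSym; apply: (PresCat (pres_repr _ _) (pres_repr _ _)).
Qed.

Lemma wordg_cons2 l l' (w : word X) :
  wordg [:: l, l' & w] = wordg [:: l] * wordg (l' :: w).
Proof. exact: wordg_cat [:: l] _. Qed.

Lemma wordg_nil : wordg [::] = 1.
Proof. by []. Qed.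

Lemma wordg_flip x b : wordg [:: (x, ~~ b)] = (wordg [:: (x, b)])^-1.
Proof.
apply/esym/mulg1_eq; rewrite -wordg_cat; exact/wordgP/PresCancel.
Qed.

Lemma wordg_letter x b :
  wordg [:: (x, b)] = if b then (wordg [:: (x, false)])^-1 else wordg [:: (x, false)].
Proof. by case: b => //; apply: wordg_flip x false. Qed.

Lemma wordg_commute a b :
  wordg [:: (a, false); (b, false); (a, true); (b, true)] = 1 ->
  forall c d, commute (wordg [:: (a, c)]) (wordg [:: (b, d)]).
Proof.
rewrite !wordg_cons2 !(wordg_letter _ true) !mulgA => /divg1_eq/(canRL (mulgVK _)) ab.
have {}ab d : commute (wordg [:: (a, false)]) (wordg [:: (b, d)]).
  by rewrite (wordg_letter b d); case: d => //; apply/commuteV.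
move=> c d; rewrite (wordg_letter a c); case: c; last exact: ab.
exact/commute_sym/commuteV/commute_sym/ab.
Qed.

Lemma wordg_commutator a b c d : commute (wordg [:: (a, c)]) (wordg [:: (b, d)]) ->
  wordg [:: (a, c); (b, d); (a, ~~ c); (b, ~~ d)] = 1.
Proof. by move=> ab; rewrite !wordg_cons2 !wordg_flip !mulgA ab mulgK mulgV. Qed.

(** In the form [x * y * x = y] the relation is stable under inverting [x] or [y]; both cases come
    down to [x^-1 * y * x^-1 = y]. *)
Lemma wordg_twist a b :
  wordg [:: (a, false); (b, false); (a, false); (b, true)] = 1 ->
  forall c d, wordg [:: (a, c); (b, d); (a, c); (b, ~~ d)] = 1.
Proof.
rewrite !wordg_cons2 !(wordg_letter _ true) !mulgA => /divg1_eq ab c d.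
rewrite !wordg_cons2 wordg_flip !mulgA.
set y := wordg [:: (b, d)]; set x := wordg [:: (a, c)].
suff -> : x * y * x = y by apply: mulgV.
have {}ab : wordg [:: (a, false)] * y * wordg [:: (a, false)] = y.
  rewrite /y (wordg_letter b d); case: d {y}; last by [].
  by apply: invg_inj; rewrite !invgM invgK -{1}ab mulgK mulKg.
rewrite /x wordg_letter; case: c {x}; last by [].
by rewrite -{1}ab !mulgA mulVg mul1g mulgK.
Qed.

Lemma wordg_rot l w : wordg (l :: w) = 1 -> wordg (rcons w l) = 1.
Proof.
rewrite -cat1s wordg_cat -cats1 wordg_cat => /mulg1_eq <-; exact: mulVg.
Qed.

End Presented.

Section Order.
Local Open Scope group_scope.
Variables (G : groupType) (P : G -> Prop).
Hypotheses (P1 : ~ P 1) (PM : forall g h, P g -> P h -> P (g * h)).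
Hypothesis (PV : forall g, g <> 1 -> P g \/ P g^-1).

Definition cone_le : rel G := fun g h => `[< g = h \/ P (g^-1 * h) >].

Lemma cone_total : total_order cone_le.
Proof.
split.
- by move=> g; apply/asboolP; left.
- move=> g h /andP[/asboolP[//|gh] /asboolP[//|hg]].
  by case: P1; have := PM gh hg; rewrite mulgA mulgK mulVg.
- move=> h g k /asboolP[->//|gh] /asboolP[<-|hk]; apply/asboolP; right=> //.
  by have := PM gh hk; rewrite mulgA mulgK.
- move=> g h; apply/orP; have [->|/eqP gh] := eqVneq g h.
    by left; apply/asboolP; left.
  have /PV[Pg|Pg] : g^-1 * h <> 1.
  + by move=> /mulg1_eq; rewrite invgK.
  + by left; apply/asboolP; right.
  + by right; apply/asboolP; right; move: Pg; rewrite invgM invgK.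
Qed.

Lemma cone_le_mul2l f g h : cone_le g h -> cone_le (f * g) (f * h).
Proof.
move=> /asboolP[->|gh]; apply/asboolP; [by left|right].
by rewrite invgM -mulgA mulKg.
Qed.

Lemma cone_left_orderable : left_orderable G.
Proof.
by exists cone_le; split; [apply: cone_total | apply: cone_le_mul2l].
Qed.

Lemma cone_bi_orderable :
  (forall g h, P g -> P (h^-1 * g * h)) -> bi_orderable G.
Proof.
move=> PJ; exists cone_le; split; [exact: cone_total | exact: cone_le_mul2l |].
move=> f g h /asboolP[->|gh]; apply/asboolP; [by left|right].
by rewrite invgM -mulgA (mulgA _ h) mulgA; apply: PJ.
Qed.

Lemma cone_expg g n : P g -> P (g ^+ n.+1).
Proof. by move=> Pg; elim: n => // n IHn; rewrite expgS; apply: PM. Qed.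

Lemma cone_torsion_free : torsion_free G.
Proof.
move=> g [//|n] _ gn1; apply: contrapT => /PV[] /(cone_expg n).
  by rewrite gn1.
by rewrite expVgn gn1 invg1.
Qed.

End Order.

(** * The Magnus pairing on right-angled Artin groups *)

Section Coef.
Variables (V : choiceType) (adj : rel V).
Implicit Types (s t : seq (V * int)) (f : seq V -> int).

(* The value at [f] of the product of the factors 1 + k X_v, for [f] a linear
   functional on the free algebra given by its values on words. *)
Fixpoint magnus s f : int :=
  if s is (v, k) :: s' then magnus s' f + k * magnus s' (fun m => f (v :: m))
  else f [::].

Lemma eq_magnus s f g : f =1 g -> magnus s f = magnus s g.
Proof.
elim: s f g => [|[v k] s IHs] f g fg //=.
by congr (_ + _ * _); apply: IHs => // m; apply: fg.
Qed.

Lemma magnusD s f g : magnus s (fun m => f m + g m) = magnus s f + magnus s g.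
Proof. by elim: s f g => [|[v k] s IHs] f g //=; rewrite !IHs; ring. Qed.

Lemma magnus0 s : magnus s (fun=> 0) = 0.
Proof. by elim: s => [|[v k] s IHs] //=; rewrite IHs; ring. Qed.

Lemma magnus_eq0 s f : f =1 (fun=> 0) -> magnus s f = 0.
Proof. by move=> f0; rewrite (eq_magnus s f0) magnus0. Qed.

Lemma magnusZ s c f : magnus s (fun m => c * f m) = c * magnus s f.
Proof. by elim: s f => [|[v k] s IHs] f //=; rewrite !IHs; ring. Qed.

Lemma magnus_sum s n (F : nat -> seq V -> int) :
  magnus s (fun m => \sum_(i < n) F i m) = \sum_(i < n) magnus s (F i).
Proof.
elim: n => [|n IHn].
  by rewrite big_ord0 magnus_eq0 // => m; rewrite big_ord0.
rewrite big_ord_recr /= -IHn -magnusD; apply: eq_magnus => m.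
by rewrite big_ord_recr.
Qed.

Lemma magnus_cat s t f :
  magnus (s ++ t) f = magnus s (fun p => magnus t (fun q => f (p ++ q))).
Proof. by elim: s f => [|[v k] s IHs] f //=; rewrite !IHs. Qed.

(* [f] factors through the quotient of the free algebra by the relations
   X_a X_b = X_b X_a for adjacent a, b and X_a X_a = 0. *)
Definition admissible f : Prop :=
  (forall p a b q, adj a b -> f (p ++ [:: a, b & q]) = f (p ++ [:: b, a & q]))
  /\ (forall p a q, f (p ++ [:: a, a & q]) = 0).

Lemma admissible_shift f p : admissible f -> admissible (fun q => f (p ++ q)).
Proof.
by case=> fC f0; split=> *; rewrite !catA; [apply: fC | apply: f0].
Qed.

Lemma admissible_magnus t f :
  admissible f -> admissible (fun p => magnus t (fun q => f (p ++ q))).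
Proof.
case=> fC f0; split=> [p a b q ab | p a q].
  by apply: eq_magnus => r; rewrite -!catA /= fC.
by apply: magnus_eq0 => r; rewrite -!catA /= f0.
Qed.

Definition syl (l : V * bool) : V * int := (l.1, (-1) ^+ l.2).

Definition raag_relators : set (word V) :=
  [set w | exists a b, adj a b /\
     w = [:: (a, false); (b, false); (a, true); (b, true)]].

Definition raag : groupType := presented raag_relators.

(** Modulo the relations that [f] respects, [1 + X] and [1 - X] are inverse to each other because
    [X^2 = 0], and factors at adjacent vertices commute. *)
Lemma magnus_pres (u w : word V) f :
  pres_eq raag_relators u w -> admissible f ->
  magnus (map syl u) f = magnus (map syl w) f.
Proof.
move=> uw; elim: uw f => {u w}.
- by [].
- by move=> u w _ IH f af; rewrite IH.
- by move=> u v w _ IH1 _ IH2 f af; rewrite IH1 // IH2.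
- move=> u u' w w' _ IHu _ IHw f af; rewrite !map_cat !magnus_cat.
  rewrite IHu; last exact: admissible_magnus.
  by apply: eq_magnus => p; apply/IHw/admissible_shift.
- move=> x b f [fC f0] /=; rewrite (f0 [::] x [::]); case: b => /=; ring.
- move=> r [a [b [ab ->]]] f [fC f0] /=.
  have f00 := f0 [::]; have fa0 := f0 [:: a]; have fC0 := fC [::].
  rewrite /= in f00 fa0 fC0.
  have ba1 p : f [:: b, a & p] = f [:: a, b & p] by rewrite (fC0 a b).
  have aba p : f [:: a, b, a & p] = 0.
    by rewrite -(fC [:: a] a b p ab) /= f00.
  by rewrite !(ba1, f00, aba, fa0); ring.
Qed.

(** The value is computed on the chosen representative word; for admissible [f] it depends on [g]
    only. *)
Definition pairing (g : raag) f := magnus (map syl (repr g)) f.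

Lemma pairing_wordg w f : admissible f -> pairing (wordg _ w) f = magnus (map syl w) f.
Proof. by move=> af; apply: magnus_pres => //; apply: pres_repr. Qed.

Local Open Scope group_scope.

Lemma pairingM (g h : raag) f :
  admissible f -> pairing (g * h) f = pairing g (fun p => pairing h (fun q => f (p ++ q))).
Proof.
move=> af; rewrite -[in LHS](wordgK g) -[in LHS](wordgK h) -wordg_cat.
by rewrite pairing_wordg // map_cat magnus_cat.
Qed.

Lemma pairing1 f : admissible f -> pairing 1 f = f [::].
Proof. by move=> af; rewrite -wordg_nil pairing_wordg. Qed.

End Coef.

(** * Reduced words and faithfulness of the Magnus pairing *)

Section Expz.
Variable G : groupType.
Implicit Types (g h : G) (k l : int).
Local Open Scope group_scope.

Definition expz g k : G :=
  match k with Posz n => g ^+ n | Negz n => g ^- n.+1 end.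

Lemma expz1D g k : expz g (1 + k)%R = g * expz g k.
Proof.
case: k => [n|[|n]]; first by rewrite -PoszD add1n /= expgS.
  by rewrite /= expg1 mulgV.
rewrite [(1 + _)%R](_ : _ = Negz n); last lia.
by rewrite /= (expgSr g n.+1) invgM mulVKg.
Qed.

Lemma expzD g k l : expz g (k + l)%R = expz g k * expz g l.
Proof.
elim: k => [|n IHn|n IHn]; first by rewrite add0r mul1g.
  by rewrite intS -addrA !expz1D IHn mulgA.
apply: (mulgI g); rewrite mulgA -!expz1D.
by rewrite [(1 + - _)%R](_ : _ = - n%:Z)%R -?IHn; [congr (expz g _)|]; lia.
Qed.

Lemma expzN g k : expz g (- k)%R = (expz g k)^-1.
Proof. by apply/esym/mulg1_eq; rewrite -expzD subrr. Qed.

Lemma commute_expz g h k : commute g h -> commute g (expz h k).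
Proof. by move=> gh; case: k => n; rewrite /=; [|apply: commuteV]; apply: commuteX. Qed.

Lemma commute_expz2 g h k l : commute g h -> commute (expz g k) (expz h l).
Proof. by move=> gh; do 2!apply/commute_sym/commute_expz. Qed.

End Expz.

Section Trace.
Variables (V : choiceType) (adj : rel V).
Hypothesis adj_sym : symmetric adj.

(** Equality in the partially commutative (Cartier-Foata) monoid. *)
Inductive trace_eq : seq V -> seq V -> Prop :=
| trace_refl m : trace_eq m m
| trace_trans m1 m2 m3 : trace_eq m1 m2 -> trace_eq m2 m3 -> trace_eq m1 m3
| trace_swap p a b q : adj a b -> trace_eq (p ++ [:: a, b & q]) (p ++ [:: b, a & q]).

Lemma trace_sym m1 m2 : trace_eq m1 m2 -> trace_eq m2 m1.
Proof.
elim=> {m1 m2} [m|m1 m2 m3 _ h1 _ h2|p a b q ab]; first exact: trace_refl.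
  exact: trace_trans h2 h1.
by apply: trace_swap; rewrite adj_sym.
Qed.

Lemma trace_size m1 m2 : trace_eq m1 m2 -> size m1 = size m2.
Proof. by elim=> {m1 m2} [//|m1 m2 m3 _ -> _ ->//|p a b q ab]; rewrite !size_cat. Qed.

Definition sqfree (m : seq V) := forall p a q, ~ trace_eq m (p ++ [:: a, a & q]).

(** The functional that reads off the coefficient of the monomial of [m]. *)
Definition indic (m m' : seq V) : int := `[< trace_eq m m' >]%:R.

Lemma indic_admissible m : sqfree m -> admissible adj (indic m).
Proof.
move=> sq; split=> [p a b q ab | p a q]; last first.
  by rewrite /indic; case: asboolP => // /sq.
rewrite /indic; congr (nat_of_bool _)%:R; apply/asboolP/asboolP => h.
  by apply: trace_trans h (trace_swap _ _ ab).
by apply: trace_trans h (trace_swap _ _ _); rewrite adj_sym.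
Qed.

Definition homog d (f : seq V -> int) := forall m, size m != d -> f m = 0.

Lemma indic_homog m : homog (size m) (indic m).
Proof.
move=> m' mm'; rewrite /indic; case: asboolP => // /trace_size mE.
by rewrite mE eqxx in mm'.
Qed.

Lemma homog_cons d f v : homog d.+1 f -> homog d (fun m => f (v :: m)).
Proof. by move=> fd m md; apply: fd. Qed.

Lemma magnus_lt s d f : homog d f -> (size s < d)%N -> magnus s f = 0.
Proof.
elim: s d f => [|[v k] s IHs] d f fd /=; first by move=> d0; rewrite fd // neq_ltn d0.
case: d fd => // d fd sd; rewrite (IHs d.+1) ?(ltnW sd) //.
by rewrite (IHs d) ?mulr0 //; apply: homog_cons.
Qed.

(* Choosing X_v in every factor is the only way to reach degree [size s]. *)
Lemma magnus_top s f : homog (size s) f ->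
  magnus s f = (\prod_(x <- s) x.2) * f [seq x.1 | x <- s].
Proof.
elim: s f => [|[v k] s IHs] f fd /=; first by rewrite big_nil mul1r.
rewrite (magnus_lt fd) //= add0r big_cons /= IHs ?mulrA //.
exact: homog_cons.
Qed.

End Trace.

Section Syllables.
Variables (V : choiceType) (adj : rel V).
Hypothesis adj_sym : symmetric adj.
Local Notation A := (raag adj).
Implicit Types (s : seq (V * int)).
Local Open Scope group_scope.

Definition gen (v : V) : A := wordg _ [:: (v, false)].

Lemma raag_commute a b c d : adj a b ->
  commute (wordg _ [:: (a, c)] : A) (wordg _ [:: (b, d)]).
Proof. by move=> ab; apply: wordg_commute; apply/wordgP/PresRel; exists a, b. Qed.

Definition syl_eval s : A := foldr (fun x g => expz (gen x.1) x.2 * g) 1 s.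

Lemma syl_eval_cat s t : syl_eval (s ++ t) = syl_eval s * syl_eval t.
Proof. by elim: s => [|x s IHs] /=; rewrite ?mul1g // IHs mulgA. Qed.

Lemma syl_eval_wordg w : syl_eval (map (@syl V) w) = wordg _ w.
Proof.
elim: w => [|[v b] w IHw] //=.
rewrite -[_ :: w]cat1s wordg_cat IHw wordg_letter; congr (_ * _).
by case: b; rewrite /= ?expr1.
Qed.

Lemma syl_eval_surj (g : A) : exists s, syl_eval s = g.
Proof. by exists (map (@syl V) (repr g)); rewrite syl_eval_wordg wordgK. Qed.

(** As [X^2 = 0], the n-th power of [1 + c X] is [1 + n c X]; here [c] is 1 or -1. *)
Lemma pairing_letterX v b n f : admissible adj f ->
  pairing ((wordg _ [:: (v, b)] : A) ^+ n) f = (f [::] + (-1) ^+ b * n%:R * f [:: v])%R.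
Proof.
elim: n f => [|n IHn] f af; first by rewrite expg0 pairing1 //; ring.
rewrite expgS pairingM // pairing_wordg /=; last exact: admissible_magnus.
have fvv : f [:: v; v] = 0%R by case: af => _ /(_ [::] v [::]).
have IHv := IHn (fun q => f (v :: q)) (admissible_shift [:: v] af).
by rewrite IHn // IHv fvv -[in RHS]natr1; ring.
Qed.

Lemma pairing_expz v k f : admissible adj f ->
  pairing (expz (gen v) k) f = (f [::] + k * f [:: v])%R.
Proof.
move=> af; case: k => n /=; first by rewrite pairing_letterX // natz; ring.
rewrite -expVgn -(wordg_letter _ v true) pairing_letterX // NegzE natz; ring.
Qed.

Lemma pairing_syl_eval s f : admissible adj f -> pairing (syl_eval s) f = magnus s f.
Proof.
elim: s f => [|[v k] s IHs] f af /=; first by rewrite pairing1.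
rewrite pairingM // pairing_expz; last exact: admissible_magnus.
by rewrite !IHs //; apply: admissible_shift [:: v] af.
Qed.

(** Each swap of letters is carried out on whole syllables, whose powers commute in the group as
    well. *)
Lemma trace_lift s m : trace_eq adj [seq x.1 | x <- s] m ->
  exists s', [/\ [seq x.1 | x <- s'] = m, perm_eq s s' & syl_eval s' = syl_eval s].
Proof.
move Em1: [seq x.1 | x <- s] => m1 h.
elim: h s Em1 => {m1 m} [m|m1 m2 m3 _ IH1 _ IH2|p a b q ab] s.
- by exists s.
- move=> /IH1 [s1 [/IH2 [s2 [s2m ss2 svs2]] ss1 svs1]]; exists s2; split=> //.
    exact: perm_trans ss1 ss2.
  by rewrite svs2.
- move=> Es.
  have [p' [s' [Ess' [Ep]]]] : exists p' s', s = p' ++ s' /\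
     (map fst p' = p /\ map fst s' = [:: a, b & q]).
    exists (take (size p) s), (drop (size p) s); rewrite cat_take_drop; split=> //.
    by rewrite map_take map_drop Es take_size_cat // drop_size_cat.
case: s' Ess' => [|[a' k] [|[b' l] q']] //= -> [-> -> <-].
  exists (p' ++ [:: (b, l), (a, k) & q']); split.
  + by rewrite map_cat Ep.
  + by rewrite perm_cat2l (perm_catCA [:: (a, k)] [:: (b, l)] q').
  + rewrite !syl_eval_cat /= !mulgA; congr (_ * _); rewrite -!mulgA; congr (_ * _).
    by apply: commute_expz2; apply: raag_commute; rewrite adj_sym.
Qed.

Definition reduced s :=
  sqfree adj [seq x.1 | x <- s] /\ all (fun x => x.2 != 0%R) s.

(** Either a syllable with exponent 0 is dropped, or two syllables on the same generator are brought
    together and merged. *)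
Lemma not_reduced_shorten s : ~ reduced s ->
  exists2 s', (size s' < size s)%N & syl_eval s' = syl_eval s.
Proof.
move=> nred; have [nz|] := boolP (all (fun x => x.2 != 0%R) s); last first.
  rewrite -has_predC => /hasP[[v k] vks /=]; rewrite negbK => /eqP k0.
  move: vks; rewrite k0 => /path.splitPr[s1 s2].
  by exists (s1 ++ s2); rewrite ?syl_eval_cat /= ?mul1g // !size_cat /= addnS.
have [p [a [q]]] : exists p a q, trace_eq adj [seq x.1 | x <- s] (p ++ [:: a, a & q]).
  by apply: contrapT => sq; apply: nred; split=> // p a q h; apply: sq; exists p, a, q.
move=> /trace_lift[s' [Es' /perm_size -> <-]].
have [p' [s1 [Ess' [Ep]]]] : exists p' s1, s' = p' ++ s1 /\
     (map fst p' = p /\ map fst s1 = [:: a, a & q]).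
  exists (take (size p) s'), (drop (size p) s'); rewrite cat_take_drop; split=> //.
  by rewrite map_take map_drop Es' take_size_cat // drop_size_cat.
case: s1 Ess' => [|[a' k] [|[b' l] q']] //= -> [-> -> _].
exists (p' ++ (a, k + l)%R :: q'); first by rewrite !size_cat /= !addnS.
by rewrite !syl_eval_cat /= expzD !mulgA.
Qed.

Lemma reduced_exists s : exists2 s', reduced s' & syl_eval s' = syl_eval s.
Proof.
elim: (size s) {-2}s (leqnn (size s)) => [|n IHn] {}s sn;
  have [|/not_reduced_shorten[s' s's <-]] := pselect (reduced s); try by exists s.
  by case: s sn s's.
by apply: IHn; rewrite -ltnS (leq_trans s's).
Qed.

Lemma prod_neq0 s : all (fun x => x.2 != 0%R) s -> (\prod_(x <- s) x.2 != 0 :> int)%R.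
Proof.
by elim: s => [|x s IHs] /=; rewrite ?big_nil // big_cons mulf_eq0 negb_or => /andP[-> /IHs].
Qed.

Lemma pairing_indic_reduced s : reduced s ->
  pairing (syl_eval s) (indic adj [seq x.1 | x <- s]) != 0%R.
Proof.
move=> [sq nz]; rewrite pairing_syl_eval; last exact: indic_admissible.
rewrite magnus_top; last by have := @indic_homog _ adj [seq x.1 | x <- s]; rewrite size_map.
by rewrite /indic asboolT ?mulr1 ?prod_neq0 //; apply: trace_refl.
Qed.

(** A nonempty reduced form of [g] is detected by the indicator of its own underlying word. Degree 0
    is excluded since the constant term is always 1. *)
Lemma pairing_faithful (g : A) :
  (forall d f, (0 < d)%N -> admissible adj f -> homog d f -> pairing g f = 0%R) -> g = 1.
Proof.
have [s <- gf] := syl_eval_surj g; have [[|x s'] red svE] := reduced_exists s.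
  by rewrite -svE.
move: gf (pairing_indic_reduced red); rewrite -svE => gf /eqP[].
by apply: (gf _ _ _ _ (@indic_homog _ _ _)) => //; apply: indic_admissible => //; case: red.
Qed.

End Syllables.

(** * A bi-invariant order on right-angled Artin groups *)

(** The well-ordering theorem for strict orders. Applied to the functionals, it singles out a
    leading coefficient within a given degree. *)
Lemma wo_exists (T : Type) : exists lt : T -> T -> Prop,
  [/\ forall P : T -> Prop, (exists x, P x) -> exists2 x, P x & forall y, lt y x -> ~ P y,
      forall x y, [\/ lt x y, x = y | lt y x] &
      forall x y z, lt x y -> lt y z -> lt x z].
Proof.
have [R wo] := wochoice.well_ordering_principle {classic T}.
have minR (P : T -> Prop) : (exists x, P x) -> exists2 x, P x & forall y, P y -> R x y.
  move=> [x Px]; have [|z [[zP minz] _]] := wo (fun y => `[< P y >]).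
    by exists x; apply/asboolP.
  by exists z => [|y Py]; [apply/asboolP | apply/minz/asboolP].
(* Both [x] and [y] are least in the pair they form, and least elements are unique. *)
have anti (x y : T) : R x y -> R y x -> x = y.
  move=> xy yx; have [|z [_ zu]] := wo (fun z => (z == x) || (z == y)).
    by exists x; rewrite unfold_in eqxx.
  have Rxx (u : T) : R u u.
    by have [|v -> /(_ u erefl)] := minR (fun v => v = u); first by exists u.
  have zx : z = x.
    apply: zu; split=> [|u]; first by rewrite unfold_in eqxx.
    by rewrite unfold_in => /orP[] /eqP ->.
  have zy : z = y.
    apply: zu; split=> [|u]; first by rewrite unfold_in eqxx orbT.
    by rewrite unfold_in => /orP[] /eqP ->.
  by rewrite -zx zy.
exists (fun x y => R x y /\ x <> y); split.
- move=> P /minR[x Px xmin]; exists x => // y [yx nyx] /xmin xy.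
  exact/nyx/anti.
- move=> x y; have [->|/eqP nxy] := eqVneq (x : {classic T}) y; first by constructor 2.
  have [|z [->|->] zmin] := minR (fun z => z = x \/ z = y); first by exists x; left.
    by constructor 1; split=> //; apply: zmin; right.
  by constructor 3; split; [apply: zmin; left | exact/nesym].
- move=> x y z [xy nxy] [yz nyz].
  have [|t tE tmin] := minR (fun t => [\/ t = x, t = y | t = z]).
    by exists x; constructor 1.
  have tx : R t x by apply: tmin; constructor 1.
  have ty : R t y by apply: tmin; constructor 2.
  have tz : R t z by apply: tmin; constructor 3.
  case: tE => tE; rewrite tE in tx ty tz.
  + split=> // xz; apply: nyz; apply: anti => //.
    by rewrite -xz.
  + by case: nxy; apply: anti.
  + by case: nyz; apply: anti.
Qed.

Section RaagOrder.
Variables (V : choiceType) (adj : rel V).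
Hypothesis adj_sym : symmetric adj.
Local Notation A := (raag adj).
Implicit Types (g h : A) (f : seq V -> int).

(** The Magnus image of [g] is 1 up to terms of degree at least [d]. *)
Definition vanish g d := forall e f,
  (0 < e < d)%N -> admissible adj f -> homog e f -> pairing g f = 0.

Lemma admissible_component f i :
  admissible adj f -> admissible adj (fun p => (size p == i)%:R * f p).
Proof.
move=> [fC f0]; split=> [p a b q ab | p a q]; last by rewrite f0 mulr0.
by rewrite fC // !size_cat.
Qed.

Lemma magnus_homog0 s f : homog 0 f -> magnus s f = f [::].
Proof.
elim: s f => [|[v k] s IHs] f f0 //=.
by rewrite IHs // magnus_eq0 ?mulr0 ?addr0 // => m; apply: f0.
Qed.

Lemma pairing_homog0 g f : homog 0 f -> pairing g f = f [::].
Proof. exact: magnus_homog0. Qed.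

(** The degree [d] part of a product sums the products of parts of complementary degrees. As [h] has
    no terms in degrees strictly between 0 and [d], only the two extreme summands remain. *)
Lemma pairingM_vanishr g h d f :
  vanish h d -> (0 < d)%N -> admissible adj f -> homog d f ->
  pairing (g * h)%g f = pairing g f + pairing h f.
Proof.
move=> hd d0 af fd; rewrite pairingM //.
rewrite [LHS](@eq_magnus _ _ _ (fun p => f p + pairing h f * (p == [::])%:R)).
  rewrite magnusD magnusZ [X in _ * X]pairing_homog0 ?mulr1 //.
  by case.
move=> [|x p]; first by rewrite fd ?mulr1 ?add0r // neq_ltn d0.
rewrite mulr0 addr0; case: (ltngtP (size (x :: p)) d) => pd.
- rewrite [RHS]fd ?neq_ltn ?pd //; apply: (hd (d - size (x :: p))%N).
  + by rewrite /=; move: pd => /=; lia.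
  + exact: admissible_shift.
  + by move=> m md; apply: fd; rewrite size_cat; apply: contra md => /eqP <-; rewrite addKn.
- rewrite [RHS]fd ?neq_ltn ?pd ?orbT //; apply: magnus_eq0 => m.
  by rewrite fd // size_cat neq_ltn (leq_trans pd) ?orbT // leq_addr.
- rewrite pairing_homog0 ?cats0 // => -[|y m] // _; rewrite fd // size_cat -pd.
  by rewrite -[X in _ != X]addn0 eqn_add2l.
Qed.

Lemma pairingM_vanishl g h d f :
  vanish g d -> (0 < d)%N -> admissible adj f -> homog d f ->
  pairing (g * h)%g f = pairing g f + pairing h f.
Proof.
move=> gd; case: d gd => // d gd _ af fd; rewrite pairingM //.
set psi := fun p => _.
have apsi : admissible adj psi by apply: admissible_magnus.
(* [psi] is not homogeneous, so it is split by length. The degree is now [d.+1], whence the lengths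
   0 to [d.+1]; on longer words [psi] vanishes. *)
rewrite [LHS](@eq_magnus _ _ _ (fun p => \sum_(i < d.+2) (size p == i)%:R * psi p)).
  rewrite (@magnus_sum _ _ _ (fun i p => (size p == i)%:R * psi p)).
  rewrite big_ord_recl big_ord_recr /= big1 => [|i _].
    rewrite add0r addrC; congr (_ + _).
      apply: eq_magnus => p; case: (eqVneq (size p) d.+1) => pd /=.
        rewrite mul1r /psi pairing_homog0 ?cats0 // => -[|y m] // _.
        by rewrite fd // size_cat pd -[X in _ != X]addn0 eqn_add2l.
      by rewrite mul0r fd.
    rewrite magnus_homog0 /= ?mul1r // => m /negPf ->; exact: mul0r.
  apply: (gd (lift ord0 i : nat)); first by rewrite /= /bump /=; have := ltn_ord i; lia.
    exact: admissible_component.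
  by move=> m; rewrite /= /bump /= => /negPf ->; rewrite mul0r.
move=> p; have [pd|pd] := ltnP (size p) d.+2.
  rewrite (bigD1 (Ordinal pd)) //= eqxx mul1r big1 ?addr0 // => i.
  by rewrite -val_eqE /= eq_sym => /negPf ->; rewrite mul0r.
rewrite big1 => [|i _]; last first.
  by rewrite gtn_eqF ?mul0r // (leq_trans (ltn_ord i)).
apply: magnus_eq0 => m; apply: fd; rewrite size_cat neq_ltn.
by rewrite (leq_trans pd (leq_addr _ _)) orbT.
Qed.

Lemma pairingV g f :
  (forall h, pairing (g * h)%g f = pairing g f + pairing h f) -> admissible adj f ->
  pairing g^-1%g f = f [::] - pairing g f.
Proof. by move=> gM af; rewrite -(pairing1 af) -(mulgV g) gM; ring. Qed.

Section Cone.
Variable lt : (seq V -> int) -> (seq V -> int) -> Prop.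
Hypothesis lt_min : forall P : (seq V -> int) -> Prop,
  (exists f, P f) -> exists2 f, P f & forall f', lt f' f -> ~ P f'.
Hypothesis lt_total : forall f f', [\/ lt f f', f = f' | lt f' f].
Hypothesis lt_trans : forall f1 f2 f3, lt f1 f2 -> lt f2 f3 -> lt f1 f3.

(** Nothing lexicographically before [(d, f)] detects [g]. That [f] itself detects [g], and with
    which sign, is stated separately. *)
Definition leading g d f :=
  [/\ (0 < d)%N, admissible adj f, homog d f, vanish g d &
     forall f', admissible adj f' -> homog d f' -> lt f' f -> pairing g f' = 0].

Lemma leading_exists g : g <> 1%g -> exists d f, leading g d f /\ pairing g f != 0.
Proof.
move=> g1; pose Q d f := [/\ (0 < d)%N, admissible adj f, homog d f & pairing g f != 0].
have exQ : exists d, `[< exists f, Q d f >].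
  apply: contrapT => nQ; apply/g1/pairing_faithful => // d f d0 af fd.
  apply/eqP/negP => gf; apply: nQ; exists d; apply/asboolP; exists f.
  by split=> //; apply/negP.
case: (ex_minnP exQ) => d /asboolP exf dmin.
have [f [d0 af fd gf] fmin] := lt_min exf.
exists d, f; split=> //; split=> // [e f' /andP[e0 ed] af' fe'|f' af' fd' /fmin nQ].
  apply/eqP/negPn/negP => gf'; suff /dmin : `[< exists f, Q e f >] by rewrite leqNgt ed.
  by apply/asboolP; exists f'.
by apply/eqP/negPn/negP => gf'; apply: nQ; split.
Qed.

Definition raag_pos g := exists d f, leading g d f /\ 0 < pairing g f.

Lemma raag_pos1 : ~ raag_pos 1%g.
Proof.
move=> [d [f [[d0 af fd _ _]]]]; rewrite pairing1 // fd ?ltxx // neq_ltn d0 //.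
Qed.

(** Up to the smaller of the two leading degrees the pairing is additive. Hence the
    lexicographically smaller leading pair leads the product, and at equal pairs two positive values
    add up. *)
Lemma raag_posM g h : raag_pos g -> raag_pos h -> raag_pos (g * h)%g.
Proof.
move=> [d [f [[d0 af fd gd glt] gf]]] [e [f' [[e0 af' fe' he hlt] hf']]].
have hi i : (i <= e)%N -> vanish h i.
  by move=> ie j k /andP[j0 ji]; apply: he; rewrite j0 (leq_trans ji).
have gi i : (i <= d)%N -> vanish g i.
  by move=> ie j k /andP[j0 ji]; apply: gd; rewrite j0 (leq_trans ji).
have ghM i k : (0 < i <= e)%N -> admissible adj k -> homog i k ->
    pairing (g * h)%g k = pairing g k + pairing h k.
  by move=> /andP[i0 ie]; apply: pairingM_vanishr (hi _ ie) i0.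
have gh_vanish i : (i <= d)%N -> (i <= e)%N -> vanish (g * h)%g i.
  move=> id ie j k jk ak kj; have /andP[j0 ji] := jk.
  rewrite (ghM j) ?j0 ?(leq_trans (ltnW ji)) //.
  by rewrite (gi i id j) ?(hi i ie j) ?addr0.
case: (ltngtP d e) => de.
- have dde : (0 < d <= e)%N by rewrite d0 ltnW.
  have hd k : admissible adj k -> homog d k -> pairing h k = 0.
    by apply: he; rewrite d0.
  exists d, f; split; last by rewrite (ghM d f dde) // hd // addr0.
  split=> // [|k ak kd kf]; first exact: gh_vanish (ltnW de).
  by rewrite (ghM d k dde) // hd // addr0; apply: glt.
- have ede : (0 < e <= e)%N by rewrite e0 leqnn.
  have ge k : admissible adj k -> homog e k -> pairing g k = 0.
    by apply: gd; rewrite e0.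
  exists e, f'; split; last by rewrite (ghM e f' ede) // ge // add0r.
  split=> // [|k ak ke kf]; first exact: gh_vanish (ltnW de) _.
  by rewrite (ghM e k ede) // ge // add0r; apply: hlt.
- subst e; have dd : (0 < d <= d)%N by rewrite d0 leqnn.
  have ghd := gh_vanish d (leqnn d) (leqnn d).
  case: (lt_total f f') => ff'.
  + exists d, f; split; last by rewrite (ghM d f dd) // (hlt f) // addr0.
    split=> // k ak kd kf.
    rewrite (ghM d k dd) // (glt k) // (hlt k) ?addr0 //; exact: lt_trans kf ff'.
  + subst f'; exists d, f; split; last by rewrite (ghM d f dd) // addr_gt0.
    split=> // k ak kd kf.
    by rewrite (ghM d k dd) // (glt k) // (hlt k) // addr0.
  + exists d, f'; split; last by rewrite (ghM d f' dd) // (glt f') // add0r.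
    split=> // k ak kd kf.
    rewrite (ghM d k dd) // (hlt k) // (glt k) ?addr0 //; exact: lt_trans kf ff'.
Qed.

Lemma raag_posV g : g <> 1%g -> raag_pos g \/ raag_pos g^-1%g.
Proof.
move=> /leading_exists[d [f [[d0 af fd gd glt]]]].
rewrite neq_lt => /orP[gf|gf]; [right | by left; exists d, f].
have gV i k : (0 < i <= d)%N -> admissible adj k -> homog i k ->
    pairing g^-1%g k = - pairing g k.
  move=> /andP[i0 id] ak ki; rewrite pairingV //; first by rewrite ki ?sub0r // neq_ltn i0.
  move=> h; apply: (@pairingM_vanishl _ _ i) => // j l /andP[j0 ji].
  by apply: gd; rewrite j0 (leq_trans ji).
have dd : (0 < d <= d)%N by rewrite d0 leqnn.
exists d, f; split; last by rewrite (gV d f dd) // oppr_gt0.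
split=> // [i k /andP[i0 id] ak ki|k ak kd kf].
  have ii : (0 < i <= d)%N by rewrite i0 ltnW.
  by rewrite (gV i k ii) // (gd i) ?oppr0 ?i0.
by rewrite (gV d k dd) // glt ?oppr0.
Qed.

(** For the conjugate [k], expanding both sides of [h * k = g * h] and cancelling the contribution
    of [h] gives [g] and [k] the same leading part. *)
Lemma raag_posJ g h : raag_pos g -> raag_pos (h^-1 * g * h)%g.
Proof.
set k := (_ * _ * _)%g => -[d [f [[d0 af fd gd glt] gf]]].
have hk : (h * k = g * h)%g by rewrite /k !mulgA mulgV mul1g.
have kg i l : (0 < i <= d)%N -> vanish k i -> admissible adj l -> homog i l ->
    pairing k l = pairing g l.
  move=> /andP[i0 id] ki al li; have := pairingM_vanishr h ki i0 al li.
  rewrite hk (@pairingM_vanishl _ _ i) //; last first.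
    by move=> j m /andP[j0 ji]; apply: gd; rewrite j0 (leq_trans ji).
  by rewrite addrC => /addrI.
(* Additivity in degree [i] presupposes that [k] vanishes below [i], hence the induction on the
   degree. *)
have kd i : (i <= d)%N -> vanish k i.
  elim: i => [|i IHi] id j l; first by rewrite ltn0 andbF.
  rewrite ltnS => /andP[j0]; rewrite leq_eqVlt => /orP[/eqP ji|ji] al lj; last first.
    by apply: (IHi (ltnW id) j); rewrite ?j0.
  subst j; rewrite (kg i) //; first by apply: (gd i); rewrite ?j0.
    by rewrite j0 ltnW.
  exact/IHi/ltnW.
have dd : (0 < d <= d)%N by rewrite d0 leqnn.
have kdd := kd d (leqnn d).
exists d, f; split; last by rewrite (kg d f dd).
by split=> // l al ld lf; rewrite (kg d l dd) // glt.
Qed.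

End Cone.

Lemma raag_cone : exists P : A -> Prop,
  [/\ ~ P 1%g, forall g h, P g -> P h -> P (g * h)%g,
     forall g, g <> 1%g -> P g \/ P g^-1%g & forall g h, P g -> P (h^-1 * g * h)%g].
Proof.
have [lt [lt_min lt_total lt_trans]] := wo_exists (seq V -> int).
exists (raag_pos lt); split.
- exact: raag_pos1.
- exact: raag_posM.
- exact: raag_posV.
- exact: raag_posJ.
Qed.

End RaagOrder.

(** * Sign changes and exponent sums *)

Section ExpzMorph.
Local Open Scope group_scope.

Lemma expzV (G : groupType) (g : G) k : expz g^-1 k = (expz g k)^-1.
Proof. by case: k => n /=; rewrite expVgn. Qed.

Lemma morph_expz (G H : groupType) (f : G -> H) g k :
  {morph f : x y / x * y} -> f (expz g k) = expz (f g) k.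
Proof.
move=> fM; have f1 : f 1 = 1 by apply: (mulgI (f 1)); rewrite -fM !mulg1.
have fX n : f (g ^+ n) = f g ^+ n by elim: n => // n IHn; rewrite !expgS fM IHn.
case: k => n; rewrite /= ?fX //.
by apply/esym/mulg1_eq; rewrite -fX -fM mulgV.
Qed.

End ExpzMorph.

Section Flip.
Variables (V : choiceType) (adj : rel V).
Local Notation A := (raag adj).
Implicit Types (s : seq (V * int)) (e : V -> bool).
Local Open Scope group_scope.

Definition flipw e (w : word V) : word V := [seq (l.1, l.2 (+) e l.1) | l <- w].

Lemma flipw_pres e u w : pres_eq (raag_relators adj) u w ->
  pres_eq (raag_relators adj) (flipw e u) (flipw e w).
Proof.
elim=> {u w} [u|u w _ h|u v w _ h1 _ h2|u u' v v' _ h1 _ h2|x b|r [a [b [ab ->]]]].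
- exact: PresRefl.
- exact: PresSym.
- exact: PresTrans h1 h2.
- by rewrite /flipw !map_cat; apply: PresCat.
- by rewrite /flipw /= addNb; apply: PresCancel.
- by apply/wordgP; apply/(wordg_commutator (c := e a) (d := e b))/raag_commute.
Qed.

Definition flip e (g : A) : A := wordg _ (flipw e (repr g)).

Lemma flip_wordg e w : flip e (wordg _ w) = wordg _ (flipw e w).
Proof. exact/wordgP/flipw_pres/pres_repr. Qed.

Lemma flipM e : {morph flip e : g h / g * h}.
Proof.
move=> g h; rewrite -[in LHS](wordgK g) -[in LHS](wordgK h) -wordg_cat.
by rewrite flip_wordg /flipw map_cat wordg_cat.
Qed.

Lemma flip1 e : flip e 1 = 1.
Proof. by rewrite -wordg_nil flip_wordg. Qed.

Lemma flipK e : involutive (flip e).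
Proof.
move=> g; rewrite -[in LHS](wordgK g) !flip_wordg /flipw -map_comp -[RHS]wordgK.
by congr (wordg _ _); rewrite -[RHS]map_id; apply: eq_map => -[v b] /=; rewrite addbK.
Qed.

Lemma flip_expz e v k :
  flip e (expz (gen adj v) k) = expz (gen adj v) (if e v then - k else k)%R.
Proof.
rewrite (morph_expz _ _ (flipM e)) flip_wordg /= wordg_letter.
by case: (e v); rewrite //= expzV expzN.
Qed.

Definition flips e s := [seq (x.1, if e x.1 then - x.2 else x.2)%R | x <- s].

Lemma flip_syl_eval e s : flip e (syl_eval adj s) = syl_eval adj (flips e s).
Proof.
elim: s => [|x s IHs] /=; first exact: flip1.
by rewrite flipM IHs flip_expz.
Qed.

(** The coefficient of [X_b], which is the exponent sum of [b] in [g]. *)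
Definition expo b (g : A) : int := pairing g (fun m => (m == [:: b])%:R).

Lemma admissible_single b : admissible adj (fun m => (m == [:: b])%:R).
Proof. by split=> [[|x [|y p]] c d q cd | [|x [|y p]] c q]; rewrite /= !eqseq_cons !andbF. Qed.

Lemma expoM b : {morph expo b : g h / g * h >-> (g + h)%R}.
Proof.
(* In degree 1 the vanishing condition is empty, so the pairing is additive on the whole group. *)
move=> g h; apply: (@pairingM_vanishr _ _ _ _ 1) => //.
- by move=> d f /andP[]; case: d.
- exact: admissible_single.
- by move=> m m1; case: eqP => // mb; rewrite mb in m1.
Qed.

Lemma expo1 b : expo b 1 = 0%R.
Proof. by rewrite /expo pairing1 //; apply: admissible_single. Qed.

Lemma expo_expz b v k : expo b (expz (gen adj v) k) = (k * (v == b)%:R)%R.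
Proof.
rewrite /expo pairing_expz; last exact: admissible_single.
by rewrite add0r eqseq_cons andbT.
Qed.

Lemma expo_syl_eval b s : expo b (syl_eval adj s) = (\sum_(x <- s) x.2 * (x.1 == b)%:R)%R.
Proof.
elim: s => [|x s IHs] /=; first by rewrite expo1 big_nil.
by rewrite expoM IHs big_cons expo_expz.
Qed.

Lemma expo_notin b s : b \notin [seq x.1 | x <- s] -> expo b (syl_eval adj s) = 0%R.
Proof.
move=> bs; rewrite expo_syl_eval big_seq big1 // => x xs.
case: eqP => [xb|]; last by rewrite mulr0.
by move: bs; rewrite -xb map_f.
Qed.

Lemma expo_flip e b g : expo b (flip e g) = (if e b then - expo b g else expo b g)%R.
Proof.
have [s <-] := syl_eval_surj g; rewrite flip_syl_eval !expo_syl_eval /flips big_map.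
case eb: (e b); last first.
  by apply: eq_bigr => x _ /=; case: eqP => [->|]; rewrite ?eb ?mulr0.
rewrite -sumrN; apply: eq_bigr => x _ /=.
by case: eqP => [->|]; rewrite ?eb ?mulr0 ?oppr0 ?mulr1.
Qed.

Lemma expo_parity b w : odd `|expo b (wordg _ w)| = odd (count (fun l => l.1 == b) w).
Proof.
rewrite -syl_eval_wordg; elim: w => [|[v c] w IHw] /=; first by rewrite expo1.
rewrite expoM expo_expz oddD -IHw /=; case: eqP => _; case: c; rewrite /= ?expr1 ?expr0; lia.
Qed.

End Flip.

(** * Twisted involutions *)

Section Involution.
Variables (V : choiceType) (adj : rel V).
Hypotheses (adj_sym : symmetric adj) (adj_irr : irreflexive adj).
Implicit Types (m p : seq V).
Local Notation trace_eq := (trace_eq adj).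

Lemma trace_cons v m p : trace_eq m p -> trace_eq (v :: m) (v :: p).
Proof.
elim=> {m p} [m|m1 m2 m3 _ h1 _ h2|p a b q ab]; [exact: trace_refl | exact: trace_trans h1 h2 |].
exact: (trace_swap (v :: p) _ ab).
Qed.

Lemma trace_rev m p : trace_eq m p -> trace_eq (rev m) (rev p).
Proof.
elim=> {m p} [m|m1 m2 m3 _ h1 _ h2|p a b q ab]; [exact: trace_refl | exact: trace_trans h1 h2 |].
rewrite !rev_cat !rev_cons -!cats1 -!catA /=.
by apply: trace_swap; rewrite adj_sym.
Qed.

Lemma trace_all (P : pred V) m p : trace_eq m p -> all P m = all P p.
Proof.
elim=> {m p} [//|m1 m2 m3 _ -> _ -> //|p a b q ab].
by rewrite !all_cat /= (andbCA (P a)).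
Qed.

Lemma trace_cons_rcons v m : all (adj v) m -> trace_eq (v :: m) (m ++ [:: v]).
Proof.
elim: m => [|x m IHm] /=; first by move=> _; apply: trace_refl.
by move=> /andP[vx /IHm/(trace_cons x)]; apply/trace_trans/(trace_swap [::] m vx).
Qed.

(* [v] can be moved to the end of [m]. *)
Fixpoint movable v m : bool :=
  if m is x :: m' then movable v m' || (x == v) && all (adj v) m' else false.

Lemma trace_movable v m p : trace_eq m p -> movable v m = movable v p.
Proof.
elim=> {m p} [//|m1 m2 m3 _ -> _ -> //|p a b q ab].
elim: p => [|x p IHp] /=; last first.
  by rewrite IHp (trace_all _ (trace_swap p q ab)).
case: (eqVneq a v) => [<-|av]; case: (eqVneq b _) => [ba|bv] //=; rewrite ?andbF ?orbF //.
- by rewrite ba adj_irr in ab.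
- by rewrite ab.
- by rewrite -ba adj_sym ab.
Qed.

Lemma movableP v m : movable v m -> exists p, trace_eq m (p ++ [:: v]).
Proof.
elim: m => //= x m IHm /orP[/IHm[p mp]|/andP[/eqP -> /trace_cons_rcons]].
  by exists (x :: p); apply: trace_cons.
by exists m.
Qed.

Lemma movable_cat1 v p : movable v (p ++ [:: v]).
Proof. by elim: p => [|x p IHp] /=; rewrite ?eqxx // IHp. Qed.

Lemma palindrome_commute m : trace_eq m (rev m) ->
  (forall v p, ~ trace_eq m (v :: p ++ [:: v])) ->
  forall p a q, m = p ++ a :: q -> trace_eq m (a :: q ++ p) /\ all (adj a) (q ++ p).
Proof.
move=> mrev mends.
(* By reversal [v] can also be moved to the end. If that used another occurrence of [v], then [m]
   would begin and end with [v]; so it is the same occurrence, and it passes every other letter. *)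
have front v p : trace_eq m (v :: p) -> all (adj v) p.
  move=> mvp; have := trace_rev mvp; rewrite rev_cons -cats1 => /(trace_trans mrev) mpv.
  have := trace_movable v (trace_trans (trace_sym adj_sym mvp) mpv).
  rewrite movable_cat1 /= eqxx => /orP[/movableP[p' pp']|//].
  by case: (mends v p'); apply/(trace_trans mvp)/trace_cons.
(* Moving front letters to the end one at a time brings every letter of [m] to the front. *)
have rot p q : m = p ++ q -> trace_eq m (q ++ p).
  elim/last_ind: p q => [|p v IHp] q mE; first by rewrite mE cats0; apply: trace_refl.
  have mvqp : trace_eq m (v :: q ++ p) by apply: (IHp (v :: q)); rewrite mE cat_rcons.
  apply: (trace_trans mvqp); rewrite -cats1 catA; apply: trace_cons_rcons.
  exact: front mvqp.
move=> p a q mE; split; last apply: front; exact: rot mE.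
Qed.

Variable arr : rel V.
Local Open Scope group_scope.

Lemma twisted_involution (e : V -> bool) (x : raag adj) :
  x * flip e x = 1 ->
  (forall a, e a -> exists2 b, arr a b & odd `|expo b x|) ->
  x <> 1 ->
  exists m, [/\ m != [::], {in m, forall a, exists2 b, b \in m & arr a b} &
                {in m &, forall a b, a = b \/ adj a b}].
Proof.
have [s <-] := syl_eval_surj x.
elim: (size s) {-2}s (leqnn (size s)) => [|n IHn] {x}s sn xx odde x1.
  by case: s sn {xx odde} x1.
have [red|/(not_reduced_shorten adj_sym)[s' s's svE]] := pselect (reduced adj s); last first.
  rewrite -svE in xx odde x1; apply: (IHn s') => //.
  by rewrite -ltnS (leq_trans s's).
set m := [seq z.1 | z <- s]; have [sq nz] := red.
(* Compare the top coefficients of [flip e x] and [x^-1]. *)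
have mrev : trace_eq m (rev m).
  pose s1 := rev [seq (z.1, - z.2)%R | z <- s].
  have sv1 : syl_eval adj s1 = syl_eval adj (flips e s).
    rewrite -flip_syl_eval -(mulg1_eq xx) /s1; elim: (s) => [|z t IHt]; first by rewrite /= invg1.
    rewrite map_cons rev_cons -cats1 syl_eval_cat /= mulg1 IHt invgM.
    by rewrite expzN.
  have mflip : [seq z.1 | z <- flips e s] = m by rewrite /m /flips -map_comp.
  have := @pairing_indic_reduced _ _ adj_sym (flips e s); rewrite mflip -sv1.
  have m1 : [seq z.1 | z <- s1] = rev m by rewrite /s1 map_rev -map_comp.
  rewrite pairing_syl_eval; last exact: indic_admissible.
  rewrite magnus_top; last first.
    have := @indic_homog _ adj m; congr (homog _ _).
    by rewrite /s1 size_rev !size_map.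
  rewrite m1 => h.
  have : reduced adj (flips e s).
    split; first by rewrite mflip.
    rewrite all_map; apply: sub_all nz => z /=.
    by case: (e z.1); rewrite // oppr_eq0.
  by move=> /h; rewrite /indic; case: asboolP => // _; rewrite mulr0 eqxx.
have [[v [p]]|mends] := pselect (exists v p, trace_eq m (v :: p ++ [:: v])).
  rewrite cats1 => /(trace_lift adj_sym)[s' [Es' /perm_size ss' svE]].
  rewrite -svE in xx odde x1; rewrite {}ss' in sn.
  case: s' Es' sn xx odde x1 {svE} => [//|[v' k] s'] /= [->].
  case/lastP: s' => [|s' [v'' l]]; first by case: p.
  rewrite map_rcons => /rcons_inj[_ ->]; rewrite size_rcons -cats1 syl_eval_cat /= mulg1 => sn.
  have [gk gkE] : exists gk, gk = expz (gen adj v) k by exists (expz (gen adj v) k).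
  rewrite -gkE; set x' := gk * _; have [x xE] : exists x, x = x' by exists x'.
  rewrite -xE => xx odde x1.
  (* Twisted conjugation by the first syllable merges it with the last one, which shortens the word;
     the equation and the parities of the exponent sums are preserved. *)
  pose y := gk^-1 * x * flip e gk.
  have yy : y * flip e y = 1.
    have flipV : flip e gk^-1 = (flip e gk)^-1.
      by apply/esym/mulg1_eq; rewrite -flipM mulgV flip1.
    by rewrite /y !flipM flipK flipV !mulgA mulgK -(mulgA _ x) xx mulg1 mulVg.
  have ey b : odd `|expo b y| = odd `|expo b x|.
    rewrite /y !expoM expo_flip.
    have := expoM b gk gk^-1; rewrite mulgV expo1 => gkV.
    by case: (e b); lia.
  have svy : y = syl_eval adj (s' ++ [:: (v, l + (if e v then - k else k))%R]).
    by rewrite syl_eval_cat /= mulg1 expzD /y xE /x' mulKg gkE flip_expz mulgA.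
  have yodd a : e a -> exists2 b, arr a b & odd `|expo b y|.
    by move=> /odde[b ab bx]; exists b; rewrite ?ey.
  (* If [y = 1], then [e v] would require an odd exponent sum in 1, and without [e v] the element
     [gk] is fixed by [flip e], which gives [x = 1]. *)
  have [y1|y1] := pselect (y = 1); last first.
    rewrite svy in yy yodd y1; apply: (IHn _ _ yy yodd y1).
    by rewrite size_cat addn1.
  case: x1; have := mulgK (flip e gk) (gk^-1 * x); rewrite -/y y1 mul1g.
  rewrite gkE flip_expz -gkE; case ev: (e v).
    by have [b _] := yodd v ev; rewrite y1 expo1.
  by rewrite -gkE -[LHS]mulg1 => /mulgI ->.
have {mends} mends v p : ~ trace_eq m (v :: p ++ [:: v]).
  by move=> h; apply: mends; exists v, p.
have comm := palindrome_commute mrev mends.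
exists m; split.
- by apply/eqP => m0; case: x1; rewrite -[s]revK; move: m0; rewrite /m; case: (s).
- move=> a am; have [p [q mE]] : exists p q, m = p ++ a :: q.
    by case/path.splitPr: am => p q; exists p, q.
  have [/(trace_lift adj_sym)[s' []] + + + aqp] := comm _ _ _ mE.
  case: s' => [//|[a' k] s'] [-> Es'] pss' svE.
  have k0 : k != 0%R.
    by have := perm_all (fun z => z.2 != 0%R) pss'; rewrite nz /= => /esym/andP[].
  (* All other letters are adjacent to [a], hence different from it. *)
  have aE : expo a (syl_eval adj s) = k.
    rewrite -svE /= expoM expo_expz eqxx mulr1 expo_notin ?addr0 // Es'.
    by apply/negP => /(allP aqp); rewrite adj_irr.
  have [|b ab ob] := odde a.
    (* If [e] did not invert [a], the exponent sum of [a] in [x * flip e x = 1] would be [k + k]. *)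
    apply: contraNT k0 => ea; have := expoM a (syl_eval adj s) (flip e (syl_eval adj s)).
    by rewrite xx expo1 expo_flip (negPf ea) aE => h; apply/eqP; lia.
  by exists b => //; apply: contraTT ob => /expo_notin ->.
- move=> a b am; have [p [q mE]] : exists p q, m = p ++ a :: q.
    by case/path.splitPr: am => p q; exists p, q.
  have [mt aqp] := comm _ _ _ mE.
  rewrite mE mem_cat inE orbCA => /orP[/eqP ->|bqp]; first by left.
  by right; apply: (allP aqp); rewrite mem_cat orbC.
Qed.

End Involution.

(** * Comparison of the twisted and untwisted groups *)

Section Twist.
Variables (V : choiceType) (arr : rel V).
Implicit Types (e : V -> bool) (u w : word V).

(* Reading [w] from left to right, the current [e] tells which generators are to
   be inverted; the letters v^+1 and v^-1 change it at the a with an arrow a -> v. *)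
Definition toggle e v : V -> bool := fun a => e a (+) arr a v.

Fixpoint tau e w : word V :=
  if w is (v, b) :: w' then (v, b (+) e v) :: tau (toggle e v) w' else [::].

Definition eps e w : V -> bool := foldl toggle e [seq l.1 | l <- w].

Lemma tau_cat e u w : tau e (u ++ w) = tau e u ++ tau (eps e u) w.
Proof. by elim: u e => [|[v b] u IHu] e //=; rewrite IHu. Qed.

Lemma eps_cat e u w : eps e (u ++ w) = eps (eps e u) w.
Proof. by rewrite /eps map_cat foldl_cat. Qed.

Lemma eps_count e w a : eps e w a = e a (+) odd (count (fun l => arr a l.1) w).
Proof.
rewrite /eps; elim: w e => [|[v b] w IHw] e /=; first by rewrite addbF.
by rewrite IHw /toggle oddD oddb addbA.
Qed.

Lemma map_tau e w : [seq l.1 | l <- tau e w] = [seq l.1 | l <- w].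
Proof. by elim: w e => [|[v b] w IHw] e //=; rewrite IHw. Qed.

Lemma tauK e : involutive (tau e).
Proof. by move=> w; elim: w e => [|[v b] w IHw] e //=; rewrite IHw addbK. Qed.

Lemma tau_flipw e w : tau e w = flipw e (tau (fun=> false) w).
Proof.
suff tauD e' : tau (fun a => e' a (+) e a) w = flipw e (tau e' w).
  by rewrite -tauD; congr (tau _ w); apply/funext.
elim: w e' => [|[v b] w IHw] e' //=; rewrite addbA -IHw; congr (_ :: tau _ w).
by apply/funext => a; rewrite /toggle addbAC.
Qed.

Hypothesis arr_irr : irreflexive arr.

(** Relators are tested from every state [e], as they may occur in the middle of a word. Cancelling
    pairs remain so because a letter does not toggle itself. *)
Lemma tau_pres (R S : set (word V)) :
  (forall r e, R r -> pres_eq S (tau e r) [::] /\ eps e r = e) ->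
  forall u w, pres_eq R u w ->
  forall e, pres_eq S (tau e u) (tau e w) /\ eps e u = eps e w.
Proof.
move=> RS u w; elim=> {u w} [u|u w _ h|u v w _ h1 _ h2|u u' v v' _ h1 _ h2|x b|r Rr] e.
- by split=> //; apply: PresRefl.
- by have [h1 ->] := h e; split=> //; apply: PresSym.
- by have [p1 ->] := h1 e; have [p2 ->] := h2 e; split=> //; apply: PresTrans p1 p2.
- rewrite !tau_cat !eps_cat; have [p1 ->] := h1 e; have [p2 ->] := h2 (eps e u').
  by split=> //; apply: PresCat.
- split; last by apply/funext => a; rewrite /eps /= /toggle -addbA addbb addbF.
  by rewrite /= /toggle arr_irr addbF addNb; apply: PresCancel.
- exact: RS.
Qed.

End Twist.

Section Graph.
Variable G : mixedGraph.
Local Notation V := {classic vertex G}.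

Definition adj : rel V := fun a b => `[< edge G [set a; b]%classic >].
Definition arr : rel V := fun a b => `[< exists e : oriented G, org e = a /\ tgt e = b >].

Lemma set2_inj (T : Type) (a b c d : T) : [set a; b]%classic = [set c; d]%classic ->
  (a = c /\ b = d) \/ (a = d /\ b = c).
Proof.
move=> E.
have : [set c; d]%classic a by rewrite -E; left.
have : [set c; d]%classic b by rewrite -E; right.
have : [set a; b]%classic c by rewrite E; left.
have : [set a; b]%classic d by rewrite E; right.
by do 4!case=> ?; subst; auto.
Qed.

Lemma adj_sym : symmetric adj.
Proof. by move=> a b; rewrite /adj setUC. Qed.

Lemma adj_irr : irreflexive adj.
Proof.
move=> a; apply/asboolP => aa; have [x [y [xy E]]] := edge_pair aa.
by case: (set2_inj E) => -[ax ay]; apply: xy; rewrite -ax -ay.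
Qed.

Lemma arr_adj a b : arr a b -> adj a b.
Proof.
move=> /asboolP[e [<- <-]]; apply/asboolP; rewrite -oriented_ends.
apply: oriented_edge; exact: set_valP.
Qed.

Lemma arr_asym a b : arr a b -> arr b a = false.
Proof.
move=> ab; have := arr_adj ab; move: ab => /asboolP[e [<- <-]] ad.
apply/asboolP => -[e' [E1 E2]].
have ee : e' = e by apply: val_inj; rewrite !oriented_ends E1 E2 setUC.
by move: ad; rewrite -E1 ee adj_irr.
Qed.

Lemma arr_irr : irreflexive arr.
Proof. by move=> a; apply/negP => /arr_adj; rewrite adj_irr. Qed.

Lemma adj_cases a b : adj a b ->
  [\/ (edge G `\` oriented G)%classic [set a; b]%classic, arr a b | arr b a].
Proof.
move=> /asboolP ab; have [h|nh] := pselect (oriented G [set a; b]%classic); last by constructor 1.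
have hm : [set a; b]%classic \in oriented G by apply/mem_set.
pose e : oriented G := SigSub hm.
have E : [set a; b]%classic = [set org e; tgt e]%classic by rewrite -oriented_ends.
case: (set2_inj E) => -[oe te].
  by constructor 2; apply/asboolP; exists e.
by constructor 3; apply/asboolP; exists e.
Qed.

Lemma unoriented_arr a b : (edge G `\` oriented G)%classic [set a; b]%classic ->
  [/\ adj a b, arr a b = false & arr b a = false].
Proof.
move=> [ab nab]; split; first exact/asboolP.
  apply/asboolP => -[e [ea eb]]; apply: nab; rewrite -ea -eb -oriented_ends; exact: set_valP.
by apply/asboolP => -[e [ea eb]]; apply: nab; rewrite setUC -ea -eb -oriented_ends; exact: set_valP.
Qed.

Local Notation TR := (@traag_relators G).
Local Notation AR := (raag_relators adj).
Local Open Scope group_scope.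

Lemma traag_commutator a b c d : (edge G `\` oriented G)%classic [set a; b]%classic ->
  wordg TR [:: (a, c); (b, d); (a, ~~ c); (b, ~~ d)] = 1.
Proof.
move=> ab; apply/wordg_commutator/wordg_commute/wordgP/PresRel; left.
by exists a, b.
Qed.

Lemma traag_twist a b c d : arr a b ->
  wordg TR [:: (a, c); (b, d); (a, c); (b, ~~ d)] = 1.
Proof.
move=> /asboolP[e [<- <-]]; apply/wordg_twist/wordgP/PresRel; right.
by exists e.
Qed.

Lemma eps4 e a b (x y z t : bool) :
  eps arr e [:: (a, x); (b, y); (a, z); (b, t)] = e.
Proof.
by apply/funext => v; rewrite eps_count /=; case: (arr v a); case: (arr v b); rewrite addbF.
Qed.

(** For an arrow from [a] to [b], reading [b] toggles [a], so the second [a] of the twisted relator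
    is inverted relative to the first and a commutator results. *)
Lemma traag_raag u w e : pres_eq TR u w ->
  pres_eq AR (tau arr e u) (tau arr e w) /\ eps arr e u = eps arr e w.
Proof.
move=> uw; move: e; apply: (tau_pres arr_irr) uw => r e [].
  move=> [a [b [/unoriented_arr[ab nab nba] ->]]]; split; last exact: eps4.
  apply/wordgP; rewrite /= /toggle !arr_irr nab nba !addbF.
  exact/wordg_commutator/raag_commute.
move=> [k ->]; split; last exact: eps4.
have ab : arr (org k) (tgt k) by apply/asboolP; exists k.
apply/wordgP; rewrite /= /toggle !arr_irr ab (arr_asym ab) !addbF addbT.
exact/wordg_commutator/raag_commute/arr_adj.
Qed.

Lemma raag_traag u w e : pres_eq AR u w ->
  pres_eq TR (tau arr e u) (tau arr e w) /\ eps arr e u = eps arr e w.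
Proof.
move=> uw; move: e; apply: (tau_pres arr_irr) uw => r e [a [b [/adj_cases ab ->]]].
split; last exact: eps4.
apply/wordgP; rewrite /= /toggle !arr_irr !addbF; case: ab => [h|ab|ba].
- have [_ -> ->] := unoriented_arr h; rewrite !addbF.
  exact: traag_commutator.
- rewrite ab (arr_asym ab) !addbF !addbT negbK.
  exact: traag_twist.
- rewrite ba (arr_asym ba) !addbF !addbT negbK.
  (* The arrow now points from [b] to [a], and the word obtained is a cyclic rotation of the relator
     that begins with [b]. *)
  exact: (wordg_rot (traag_twist (~~ e b) (e a) ba)).
Qed.

End Graph.

(** * Linear extensions and cycles *)

Section LinearExtension.
Variables (T : Type) (r : T -> T -> Prop).
Hypotheses (r_irr : forall x, ~ r x x) (r_trans : forall x y z, r x y -> r y z -> r x z).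

Let extension (s : T -> T -> Prop) :=
  [/\ forall x, ~ s x x, forall x y z, s x y -> s y z -> s x z & forall x y, r x y -> s x y].

(** Szpilrajn's theorem: by Zorn's lemma there is a maximal strict order containing [r], and an
    incomparable pair would allow it to be enlarged. *)
Lemma linear_extension : exists s : T -> T -> Prop,
  [/\ forall x, ~ s x x, forall x y z, s x y -> s y z -> s x z, forall x y, r x y -> s x y &
      forall x y, [\/ s x y, x = y | s y x]].
Proof.
have r_ext : extension r by split.
pose le (s t : {s | extension s}) := `[< forall x y, sval s x y -> sval t x y >].
have [|||s smax] := @ZL_preorder _ (exist _ r r_ext) le.
- by move=> s; apply/asboolP.
- by move=> s1 s2 s3 /asboolP h1 /asboolP h2; apply/asboolP => x y /h1/h2.
(* Joining [r] to the union provides a bound for the empty chain too. *)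
- move=> C Ctot; pose u x y := r x y \/ exists2 s, C s & sval s x y.
  have u_ext : extension u.
    split; last by left.
    - by move=> x [/r_irr//|[[s [s_irr _ _]] _ /s_irr]].
    - move=> x y z [xy|[s Cs xy]] [yz|[t Ct yz]].
      + by left; apply: r_trans xy yz.
      + right; exists t => //; case: (t) yz => /= t' [_ tt rt] yz.
        by apply: tt yz; apply: rt.
      + right; exists s => //; case: (s) xy => /= s' [_ ts rs] xy.
        by apply: ts xy _; apply: rs.
      + right; case: (Ctot s t Cs Ct) => /asboolP st.
          exists t => //; move: (st _ _ xy) yz; case: (t) => /= t' [_ tt _]; exact: tt.
        exists s => //; move: xy (st _ _ yz); case: (s) => /= s' [_ tt _]; exact: tt.
  by exists (exist _ u u_ext) => s Cs; apply/asboolP => x y sxy; right; exists s.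
case: s smax => s [s_irr s_trans rs] smax; exists s; split=> // x y.
apply: contrapT => nxy.
have sxy : ~ s x y by move=> h; apply: nxy; constructor 1.
have xy : x <> y by move=> h; apply: nxy; constructor 2.
have syx : ~ s y x by move=> h; apply: nxy; constructor 3.
(* The order generated by [s] and the new pair [(x, y)]. *)
pose t a b := s a b \/ (a = x \/ s a x) /\ (b = y \/ s y b).
have t_ext : extension t.
  split; last by move=> a b /rs; left.
  - move=> a [/s_irr//|[[ax|ax] [ay|ya]]].
    + by apply: xy; rewrite -ax.
    + by apply: syx; rewrite -ax.
    + by apply: syx; rewrite -ay.
    + exact/syx/(s_trans _ _ _ ya).
  - move=> a b c [ab|[ax yb]] [bc|[bx yc]].
    + by left; apply: s_trans ab bc.
    + by right; split=> //; right; case: bx => [<-//|]; apply: s_trans ab.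
    + by right; split=> //; right; case: yb => [<-//|yb]; apply: s_trans yb bc.
    + by right.
have /asboolP : le (exist _ t t_ext) (exist _ s (And3 s_irr s_trans rs)).
  by apply: smax; apply/asboolP => a b; left.
by move=> /(_ x y) /= h; apply: sxy; apply: h; right; split; left.
Qed.

End LinearExtension.

Section Cycles.
Variables (T : eqType) (r : rel T).
Implicit Types (p q m : seq T).

(** A walk inside [m] with more vertices than [m] has entries repeats a vertex; the stretch between
    two visits is a cycle. *)
Lemma cycle_of_successors m : m != [::] ->
  {in m, forall a, exists2 b, b \in m & r a b} ->
  exists p, [/\ p != [::], cycle r p & {subset p <= m}].
Proof.
case: m => // x0 m0 _; set m := x0 :: m0 => succ.
have [p [ps pm px]] : exists p, [/\ size p = (size m).+1, {subset p <= m} & sorted r p].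
  elim: (size m).+1 => [|n [p [pn pm ps]]]; first by exists [::].
  case/lastP: p pn pm ps => [|p a] pn pm ps.
    by exists [:: x0]; rewrite /= -pn; split=> // z; rewrite !inE => ->.
  have am : a \in m by apply: pm; rewrite mem_rcons mem_head.
  have [b bm ab] := succ a am.
  exists (rcons (rcons p a) b); split.
  + by rewrite size_rcons pn.
  + by move=> z; rewrite mem_rcons inE => /orP[/eqP ->|/pm].
  + by case: p ps {pn pm} => [|z p] /= ps; rewrite ?andbT // rcons_path last_rcons ps.
have nup : ~~ uniq p by apply/negP => /uniq_leq_size/(_ pm); rewrite ps ltnn.
have [p1 [y [p2 [p3 pE]]]] : exists p1 y p2 p3, p = p1 ++ y :: p2 ++ y :: p3.
  elim: (p) nup => //= z q IHq; rewrite negb_and negbK => /orP[zq|/IHq].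
    by case/splitPr: zq => q1 q2; exists [::], z, q1, q2.
  by move=> [p1 [y [p2 [p3 ->]]]]; exists (z :: p1), y, p2, p3.
exists (y :: p2); split=> // [|z zp].
  have : path r y (p2 ++ y :: p3).
    move: px; rewrite pE; case: p1 {pE} => //= z p1.
    by rewrite cat_path /= => /and3P[].
  by rewrite -cat_rcons cat_path => /andP[].
apply: pm; rewrite pE mem_cat inE mem_cat; move: zp; rewrite inE.
by case/orP => ->; rewrite ?orbT.
Qed.

(* Chords and repetitions would give shorter cycles. *)
Lemma min_cycle_count (P : pred T) p : irreflexive r ->
  p != [::] -> cycle r p -> all P p ->
  (forall q, q != [::] -> cycle r q -> all P q -> (size p <= size q)%N) ->
  {in p, forall a, count (r a) p = 1%N /\ count_mem a p = 1%N}.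
Proof.
move=> r_irr pn pc pP pmin a ap; have [i q rotE] := rot_to ap.
have rp := permEl (perm_rot i p); rewrite rotE in rp.
rewrite -!(permP rp).
have qc : cycle r (a :: q) by rewrite -rotE rot_cycle.
have qP : all P (a :: q) by rewrite (perm_all _ rp).
have ps : size p = (size q).+1 by rewrite -(perm_size rp).
have sz (q' : seq T) : q' != [::] -> cycle r q' -> all P q' -> (size q < size q')%N.
  by move=> *; rewrite -ps; apply: pmin.
case: q qc qP sz {rotE rp ps} => [|y q]; first by rewrite /= r_irr.
move=> qc qP sz; have {}qc : path r a (rcons (y :: q) a) := qc.
have aq : a \notin y :: q.
  apply/negP => aq; move: qc qP sz; case/splitPr: aq => q1 q2.
  rewrite -cats1 -catA cat_path /= => /and3P[q1c aq2 _].
  rewrite all_cat /= => /and3P[Pa q1P _] /(_ (a :: q1)) h.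
  have := h isT; rewrite /= rcons_path q1c aq2 Pa q1P => /(_ isT isT).
  by rewrite size_cat /= ltnS addnS ltnNge leq_addr.
have ay : r a y by case/andP: qc.
split; last by rewrite [LHS]/= eqxx -[X in (1 + X)%N]/(count_mem a (y :: q)) (count_memPn aq).
rewrite /= r_irr ay add0n; suff -> : count (r a) q = 0%N by [].
apply/eqP; rewrite -leqn0 leqNgt -has_count; apply/hasP => -[z zq az].
move: qc qP sz; case/splitPr: zq => q1 q2 /=.
rewrite -cats1 -catA cat_path /= => /and4P[_ _ _ zq2].
rewrite all_cat /= => /and5P[Pa _ _ Pz q2P] /(_ [:: a, z & q2]) h.
have := h isT; rewrite /= az -cats1 zq2 Pa Pz q2P => /(_ isT isT).
by rewrite size_cat /= addnS !ltnS ltnNge leq_addl.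
Qed.

Lemma cycle_trans (s : rel T) p : transitive s -> irreflexive s ->
  subrel r s -> cycle r p -> p = [::].
Proof.
move=> s_tr s_irr rs; case: p => //= x p /(sub_path rs).
move=> /(order_path_min s_tr) /allP/(_ x).
by rewrite mem_rcons mem_head s_irr => /(_ isT).
Qed.

(** The count is the sum of the multiplicities of the distinct letters satisfying [P]. The induction
    removes all occurrences of the first letter at once. *)
Lemma odd_count_ex (P : pred T) m : odd (count P m) ->
  exists2 b, P b & odd (count_mem b m).
Proof.
elim: (size m) {-2}m (leqnn (size m)) => [|n IHn] {}m mn; first by case: m mn.
case: m mn => // x m mn odP.
have xE := permP (permEl (perm_filterC (pred1 x) (x :: m))).
set m' := [seq z <- x :: m | predC (pred1 x) z] in xE.
have [odx|odx] := boolP (P x && odd (count_mem x (x :: m))).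
  by exists x; case/andP: odx.
have sm' : (size m' <= n)%N.
  by rewrite /m' /= eqxx size_filter (leq_trans (count_size _ _)).
have [|b Pb ob] := IHn m' sm'.
  move: odP; rewrite -xE count_cat oddD count_filter; move: odx.
  have [Px|nPx] := boolP (P x).
    rewrite (@eq_count _ (predI P _) (pred1 x)) => [/= /negPf -> //|z /=].
    by case: (eqVneq z x) => [->|]; rewrite ?Px ?andbF.
  rewrite (@eq_count _ (predI P _) pred0) => [|z /=]; first by rewrite count_pred0.
  by case: (eqVneq z x) => [->|]; rewrite ?andbF ?(negPf nPx).
have ob0 := ob; exists b => //; move: ob; rewrite -xE count_cat oddD.
rewrite (_ : count_mem b [seq z <- x :: m | pred1 x z] = 0%N) ?odd0 //.
rewrite count_filter (@eq_count _ _ pred0) ?count_pred0 //.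
move=> z /=; apply/negP => /andP[/eqP -> /eqP bx].
suff bm' : b \in m' by move: bm'; rewrite bx mem_filter /= eqxx.
by rewrite -has_pred1 has_count; case: (count_mem b m') ob0.
Qed.

End Cycles.

(** * Orders and torsion in the twisted group *)

Section Cocycle.
Variable G : mixedGraph.
Local Notation V := {classic vertex G}.
Local Notation adj := (@adj G).
Local Notation arr := (@arr G).
Local Notation A := (raag adj).
Local Notation TR := (@traag_relators G).
Implicit Types (g h : TRAAG G).
Local Open Scope group_scope.

(* [g |-> (untwist g, sgn g)] embeds [TRAAG G] in the semidirect product of [A]
   with the group of sign changes of the generators. *)
Definition untwist g : A := wordg _ (tau arr (fun=> false) (repr g)).
Definition sgn g : V -> bool := eps arr (fun=> false) (repr g).

Lemma untwist_wordg u : untwist (wordg TR u) = wordg _ (tau arr (fun=> false) u).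
Proof. by apply/wordgP; have [] := traag_raag (fun=> false) (pres_repr TR u). Qed.

Lemma sgn_wordg u : sgn (wordg TR u) = eps arr (fun=> false) u.
Proof. by have [] := traag_raag (fun=> false) (pres_repr TR u). Qed.

Lemma untwistM g h : untwist (g * h) = untwist g * flip (sgn g) (untwist h).
Proof.
rewrite -[in LHS](wordgK g) -[in LHS](wordgK h) -wordg_cat untwist_wordg.
by rewrite tau_cat wordg_cat flip_wordg -tau_flipw.
Qed.

Lemma sgnM g h a : sgn (g * h) a = sgn g a (+) sgn h a.
Proof.
rewrite -[in LHS](wordgK g) -[in LHS](wordgK h) -wordg_cat sgn_wordg.
by rewrite eps_cat /sgn !eps_count addbA.
Qed.

Lemma untwist1 : untwist 1 = 1.
Proof. by rewrite -wordg_nil untwist_wordg. Qed.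

(** [tau] is an involution on words and carries the relations of each group to those of the
    other. *)
Lemma untwist_eq1 g : untwist g = 1 -> g = 1.
Proof.
move=> g1; rewrite -(wordgK g) -wordg_nil; apply/wordgP.
have g1A : pres_eq (raag_relators adj) (tau arr (fun=> false) (repr g)) [::].
  exact/wordgP.
by have [] := raag_traag (fun=> false) g1A; rewrite tauK.
Qed.

(** The sign at [a] is the parity of the number of letters that [a] points to, and modulo 2
    occurrences agree with exponent sums. *)
Lemma sgn_odd g a : sgn g a -> exists2 b, arr a b & odd `|expo b (untwist g)|.
Proof.
rewrite /sgn eps_count /= -(count_map _ (arr a)) => /odd_count_ex[b ab ob].
exists b => //; rewrite expo_parity -(count_map _ (pred1 b)) map_tau.
exact: ob.
Qed.

Lemma sgn_false g a : (forall b, arr a b -> expo b (untwist g) = 0%R) -> sgn g a = false.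
Proof. by move=> h; apply/negP => /sgn_odd[b /h ->]. Qed.

Lemma flip0 (x : A) : flip (fun=> false) x = x.
Proof.
rewrite /flip -[RHS]wordgK; congr wordg; rewrite /flipw -[RHS]map_id.
by apply: eq_map => -[v b]; rewrite addbF.
Qed.

Lemma sgn_id g : (forall b, expo b (untwist g) = 0%R) -> sgn g = fun=> false.
Proof. by move=> h; apply/funext => a; apply: sgn_false => b _; apply: h. Qed.

Lemma gen_neq1 (v : V) b : wordg TR [:: (v, b)] <> 1.
Proof.
move=> v1; have := untwist_wordg [:: (v, b)]; rewrite v1 untwist1 => /(congr1 (expo v)) E.
by have := expo_parity adj v (tau arr (fun=> false) [:: (v, b)]); rewrite -E expo1 /= eqxx.
Qed.

Lemma cycle_of_seq p : p != [::] -> cycle arr p ->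
  exists n (e : 'I_n.+1 -> oriented G), oriented_cycle e /\
    forall i, org (e i) \in p /\ tgt (e i) \in p.
Proof.
case: p => // x p _ /(pathP x) pc; rewrite size_rcons in pc.
pose s := x :: p.
have ex (i : 'I_(size p).+1) : exists e : oriented G,
    org e = nth x s i :> V /\ tgt e = nth x s (ordS i) :> V.
  have /asboolP[e [eo et]] := pc i (ltn_ord i); exists e.
  suff -> : nth x s (ordS i) = nth x (rcons p x) i.
    by rewrite eo et -rcons_cons nth_rcons /= ltn_ord.
  rewrite nth_rcons /=; case: (ltngtP i (size p)) => ip.
  - by rewrite modn_small.
  - by have := ltn_ord i; rewrite ltnS leqNgt ip.
  - by rewrite ip modnn.
have [e eP] := choice ex.
exists (size p), e; split=> i.
  by rewrite (eP i).2 (eP _).1.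
by rewrite (eP i).1 (eP i).2; split; exact: (mem_nth x (s := s) (ltn_ord _)).
Qed.

Lemma seq_of_cycle n (e : 'I_n.+1 -> oriented G) : oriented_cycle e ->
  exists p : seq V, [/\ p != [::], cycle arr p & {in p, forall v, exists i, v = org (e i)}].
Proof.
(* The origins, extended periodically to all natural numbers. *)
move=> ec; pose o i : V := org (e (inord (i %% n.+1))).
have oS i : arr (o i) (o i.+1).
  apply/asboolP; exists (e (inord (i %% n.+1))); split=> //.
  rewrite ec /o; congr (org (e _)); apply: val_inj.
  by rewrite /= !inordK ?ltn_pmod // -addn1 modnDml addn1.
exists (mkseq o n.+1); split=> //; last by move=> v /mapP[i _ ->]; exists (inord (i %% n.+1)).
have o0 : o n.+1 = o 0%N by rewrite /o modnn mod0n.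
have op m k : path arr (o m) (map o (iota m.+1 k)).
  by elim: k m => //= k IHk m; rewrite oS IHk.
have oE : rcons (map o (iota 1 n)) (o 0%N) = map o (iota 1 n.+1).
  by rewrite -(addn1 n) iotaD map_cat cats1 add1n o0.
by rewrite /= oE.
Qed.

Definition has_cycle := exists n (e : 'I_n.+1 -> oriented G), oriented_cycle e.

Definition has_clique_cycle := exists n (e : 'I_n.+1 -> oriented G),
  oriented_cycle e /\ supported_on_complete e.

Lemma raag_torsion_free : torsion_free A.
Proof.
by have [P [P1 PM PV _]] := raag_cone (@adj_sym G); apply: (cone_torsion_free P1 PM PV).
Qed.

Lemma untwistX g n : sgn g = (fun=> false) -> untwist (g ^+ n) = untwist g ^+ n.
Proof.
move=> g0; elim: n => [|n IHn]; first exact: untwist1.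
by rewrite !expgS untwistM g0 flip0 IHn.
Qed.

Lemma traag_torsion_free : ~ has_clique_cycle -> torsion_free (TRAAG G).
Proof.
move=> ncyc g n n0 gn; apply: contrapT => g1.
(* Signs are of exponent two, so on powers of [g ^+ 2] the map [untwist] is multiplicative and
   torsion-freeness of [A] applies. *)
have gg : untwist (g ^+ 2) = 1.
  apply: (raag_torsion_free n0); rewrite -untwistX; last first.
    by apply/funext => a; rewrite expg2 sgnM addbb.
  by rewrite -expgnA mulnC expgnA gn expg1n untwist1.
rewrite expg2 untwistM in gg.
have [m [m0 msucc mclique]] := twisted_involution (@adj_sym G) (@adj_irr G) gg
  (@sgn_odd g) (fun E => g1 (untwist_eq1 E)).
have [p [p0 pc pm]] := cycle_of_successors m0 msucc.
have [k [e [ec ep]]] := cycle_of_seq p0 pc.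
apply: ncyc; exists k, e; split=> // U x y [i _ xi] [j _ yj].
have xm : x \in m by case: xi => ->; apply: pm; case: (ep i).
have ym : y \in m by case: yj => ->; apply: pm; case: (ep j).
by have [|/asboolP] := mclique _ _ xm ym; [left | right].
Qed.

(** The letters of [w] commute pairwise, so inverting each of them in place inverts the element. *)
Lemma raag_flip_clique (w : word V) :
  {in [seq l.1 | l <- w] &, forall a b, a = b \/ adj a b} ->
  wordg (raag_relators adj) w * wordg _ (flipw (fun=> true) w) = 1.
Proof.
have letters v c d : commute (wordg (raag_relators adj) [:: (v, c)]) (wordg _ [:: (v, d)]).
  rewrite (wordg_letter _ v c) (wordg_letter _ v d).
  by case: c; case: d; rewrite /commute ?mulgV ?mulVg.
elim: w => [|[v c] w IHw] wclique; first exact: mulg1.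
have -> : flipw (fun=> true) ((v, c) :: w) = [:: (v, ~~ c)] ++ flipw (fun=> true) w.
  by rewrite /= addbT.
rewrite -[(v, c) :: w]cat1s !wordg_cat wordg_flip.
set x := wordg _ [:: _]; set y := wordg _ w.
suff xy : commute x y.
  rewrite xy mulgA mulgK; apply: IHw => a b aw bw.
  by apply: wclique; rewrite inE ?aw ?bw orbT.
rewrite {}/y; elim: w wclique {IHw} => [|[b d] w IHw] wclique; first exact: commute1.
rewrite -cat1s wordg_cat; apply: commuteM; last first.
  by apply: IHw => a a' aw a'w; apply: wclique;
    [move: aw | move: a'w]; rewrite /= !inE => /orP[] ->; rewrite ?orbT.
have [<-|vb] : v = b \/ adj v b by apply: wclique; rewrite !inE eqxx ?orbT.
  exact: letters.
exact: raag_commute.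
Qed.

(* In a shortest oriented cycle on a clique every vertex has exactly one
   out-neighbour, so the product of its vertices has order two. *)
Lemma clique_cycle_torsion : torsion_free (TRAAG G) -> ~ has_clique_cycle.
Proof.
move=> tf [n [e [/seq_of_cycle[p0 [p0n p0c p0e]] eclique]]].
pose clique (p : seq V) := {in p &, forall a b, a = b \/ adj a b}.
(* Minimizing only among cycles through vertices of [p0] keeps the clique condition. *)
pose Q k := `[< exists p, [/\ p != [::], cycle arr p, {subset p <= p0} & size p = k] >].
have exQ : exists k, Q k by exists (size p0); apply/asboolP; exists p0; split.
case: (ex_minnP exQ) => k /asboolP[p [pn pc pp0 pk]] kmin.
have pmin q : q != [::] -> cycle arr q -> all (mem p0) q -> (size p <= size q)%N.
  by move=> qn qc /allP qp; rewrite pk; apply: kmin; apply/asboolP; exists q.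
have cnt := min_cycle_count (@arr_irr G) pn pc (introT allP pp0) pmin.
have pcl : clique p.
  move=> a b /pp0/p0e[i ->] /pp0/p0e[j ->].
  have [| |->|ab] := eclique (org (e i)) (org (e j)).
  - by exists i => //; left.
  - by exists j => //; left.
  - by left.
  - by right; apply/asboolP.
pose u := [seq (v, false) | v <- p]; pose w := tau arr (fun=> false) u.
have u1 : [seq l.1 | l <- u] = p by rewrite /u -map_comp map_id.
have g1 : wordg TR u = 1.
  apply: (tf _ 2) => //; apply: untwist_eq1.
  rewrite expg2 -wordg_cat untwist_wordg tau_cat wordg_cat -/w.
  (* After one pass along [p] every vertex of [p] has been toggled once, so the second pass reads
     [w] with all letters inverted. *)
  rewrite tau_flipw -/w -[RHS](@raag_flip_clique w); last by rewrite map_tau u1.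
  congr (_ * wordg _ _); apply/eq_in_map => -[v b] vw /=.
  rewrite eps_count -(count_map _ (arr v)) u1.
  have vp : v \in p by rewrite -u1 -(map_tau arr (fun=> false)); apply: (map_f _ vw).
  by have [-> _] := cnt v vp.
have [a ap] : exists a, a \in p by case: (p) pn => // a p' _; exists a; apply: mem_head.
(* The vertex [a] occurs once in [p], so its exponent sum is odd and the product is not trivial. *)
have := expo_parity adj a w; rewrite -untwist_wordg -/u g1 untwist1 expo1.
rewrite -(count_map _ (pred1 a)) map_tau u1.
by have [_ ->] := cnt a ap.
Qed.

(** The origin of an oriented edge is conjugate to its inverse, whereas conjugation preserves the
    sign in a bi-order. *)
Lemma bi_orderable_unoriented : bi_orderable (TRAAG G) -> oriented G = set0.
Proof.
move=> [le [[le_refl le_anti le_trans le_total] leL leR]].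
apply/seteqP; split=> // s Ds; exfalso.
have e : oriented G := SigSub (mem_set Ds).
have ab : arr (org e) (tgt e) by apply/asboolP; exists e.
have [c le1] : exists c, le 1 (wordg TR [:: (org e : V, c)]).
  pose x := wordg TR [:: (org e : V, false)].
  case/orP: (le_total 1 x) => h; first by exists false.
  by exists true; rewrite (wordg_flip _ _ false); have := leL x^-1 _ _ h; rewrite mulVg mulg1.
have := traag_twist c false ab; rewrite !wordg_cons2 wordg_flip.
set x := wordg TR _ in le1 *; set y := wordg TR _ => xyx.
have xyxV : y * x * y^-1 = x^-1 by apply/esym/mulg1_eq; rewrite !mulgA -!mulgA.
have leV : le 1 x^-1.
  by rewrite -xyxV -(mulgV y); apply: leR; rewrite -[X in le X]mulg1; apply: leL.
have x1 : x = 1.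
  apply: le_anti; rewrite le1 andbT; have := leL x _ _ leV; by rewrite mulgV mulg1.
exact: gen_neq1 x1.
Qed.

(** Without arrows all signs are trivial, so [untwist] is an injective homomorphism along which the
    cone of [A] is pulled back. *)
Lemma unoriented_bi_orderable : oriented G = set0 -> bi_orderable (TRAAG G).
Proof.
move=> D0; have noD s : ~ oriented G s by rewrite D0.
have sgn0 g : sgn g = (fun=> false).
  apply/funext => a; apply: sgn_false => b /asboolP[e _].
  by case: (noD _ (set_valP e)).
have uM g h : untwist (g * h) = untwist g * untwist h by rewrite untwistM sgn0 flip0.
have uV g : untwist g^-1 = (untwist g)^-1.
  by apply/esym/mulg1_eq; rewrite -uM mulgV untwist1.
have [P [P1 PM PV PJ]] := raag_cone (@adj_sym G).
apply: (@cone_bi_orderable _ (fun g => P (untwist g))) => [|g h|g g1|g h].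
- by rewrite untwist1.
- by rewrite uM; apply: PM.
- by rewrite uV; apply: PV => /untwist_eq1.
- by rewrite !uM uV; apply: PJ.
Qed.

(** With each generator replaced by whichever of it and its inverse is at least 1, arrows become
    strict inequalities. *)
Lemma left_orderable_acyclic : left_orderable (TRAAG G) -> ~ has_cycle.
Proof.
move=> [le [[le_refl le_anti le_trans le_total] leL]] [n [e /seq_of_cycle[p [p0 pc _]]]].
have /choice[c cP] (v : V) : exists b, le 1 (wordg TR [:: (v, b)]).
  case/orP: (le_total 1 (wordg TR [:: (v, false)])) => h.
    by exists false.
  exists true; rewrite (wordg_flip _ _ false).
  by have := leL (wordg TR [:: (v, false)])^-1 _ _ h; rewrite mulVg mulg1.
pose x v := wordg TR [:: (v, c v)].
pose lt : rel V := fun a b => le (x a) (x b) && (x a != x b).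
have lt_irr : irreflexive lt by move=> a; rewrite /lt eqxx andbF.
have lt_tr : transitive lt.
  move=> b a d /andP[ab nab] /andP[bd nbd]; rewrite /lt (le_trans _ _ _ ab bd).
  apply: contra nab => /eqP ad; apply/eqP/le_anti.
  by rewrite ab ad bd.
(* If x y x = y with x, y >= 1 then x^-1 y = y x >= 1, whence x < y. *)
suff /(cycle_trans lt_tr lt_irr)/(_ pc) : subrel arr lt by move: p0 => /eqP.
move=> a b ab; have := traag_twist (c a) (c b) ab.
rewrite !wordg_cons2 wordg_flip -/(x a) -/(x b) !mulgA => /divg1_eq xyx.
have xV : (x a)^-1 * x b = x b * x a by rewrite -{1}xyx -!mulgA mulKg.
have le_ba : le 1 (x b * x a).
  by apply: le_trans (cP b) _; have := leL (x b) _ _ (cP a); rewrite mulg1.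
rewrite /lt; apply/andP; split.
  by move: le_ba; rewrite -xV => /(leL (x a)); rewrite mulg1 mulVKg.
apply/eqP => xab; move: xV; rewrite -xab mulVg => xa2.
have xa : x a = 1.
  apply: le_anti; rewrite cP andbT -/(x a).
  by have := leL (x a) _ _ (cP a); rewrite -xa2 mulg1.
exact: gen_neq1 xa.
Qed.

Lemma acyclic_left_orderable : ~ has_cycle -> left_orderable (TRAAG G).
Proof.
move=> ncyc.
pose r (a b : V) := exists p, path arr a (rcons p b).
have r_irr a : ~ r a a.
  move=> [p pa]; apply: ncyc; have [||n [e [ec _]]] := @cycle_of_seq (a :: p) => //.
  by exists n, e.
have r_tr a b c : r a b -> r b c -> r a c.
  move=> [p pab] [q pbc]; exists (rcons p b ++ q).
  by rewrite rcons_cat cat_path pab last_rcons.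
have [lt [lt_irr lt_tr rlt lt_tot]] := linear_extension r_irr r_tr.
have arr_lt a b : arr a b -> lt a b by move=> ab; apply: rlt; exists [::]; rewrite /= ab.
have [P [P1 PM PV _]] := raag_cone (@adj_sym G).
pose E v g := expo v (untwist g).
pose above t g := forall v, lt t v -> E v g = 0%R.
pose zero g := forall v, E v g = 0%R.
(* The sign of [g] is read off the last generator with nonzero exponent sum. *)
pose Q g := (exists t, (0 < E t g)%R /\ above t g) \/ (zero g /\ P (untwist g)).
(* The sign of [g] at [v] depends on the exponent sums at heads of arrows from [v]; these heads lie
   above [t], where the sums vanish. *)
have EM g h t v : above t g -> t = v \/ lt t v -> E v (g * h) = (E v g + E v h)%R.
  move=> gt tv; rewrite /E untwistM expoM expo_flip sgn_false // => b vb; apply: gt.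
  by case: tv => [->|tv]; [apply: arr_lt | apply: lt_tr tv (arr_lt _ _ vb)].
have EM0 g h v : zero g -> E v (g * h) = (E v g + E v h)%R.
  by move=> g0; apply: (EM _ _ v) => [w _|]; [apply: g0 | left].
have above_trans s t g : above s g -> lt s t -> above t g.
  by move=> gs st v tv; apply: gs; apply: lt_tr st tv.
have aboveM t g h : above t g -> above t h -> above t (g * h).
  by move=> gt ht v tv; rewrite (EM _ _ t) ?gt ?ht ?addr0 //; right.
apply: (@cone_left_orderable _ Q).
- move=> [[t []]|[_]]; last by rewrite untwist1.
  by rewrite /E untwist1 expo1 ltxx.
- move=> g h [[s [gs gs']]|[g0 gP]] [[t [ht ht']]|[h0 hP]].
  + left; case: (lt_tot s t) => st.
    * exists t; have gt := above_trans _ _ _ gs' st; split; last exact: aboveM.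
      by rewrite (EM _ _ t) ?gs' ?add0r //; left.
    * subst t; exists s; split; last exact: aboveM.
      by rewrite (EM _ _ s) ?addr_gt0 //; left.
    * exists s; have hs := above_trans _ _ _ ht' st; split; last exact: aboveM.
      by rewrite (EM _ _ s) ?ht' ?addr0 //; left.
  + left; exists s; split; last by apply: aboveM => // v _; apply: h0.
    by rewrite (EM _ _ s) ?h0 ?addr0 //; left.
  + left; exists t; split; last by apply: aboveM => // v _; apply: g0.
    by rewrite EM0 // g0 add0r.
  + right; split; first by move=> v; rewrite EM0 // g0 h0 addr0.
    by rewrite untwistM (sgn_id g0) flip0; apply: PM.
- move=> g g1; have [nz|z] := pselect (exists v, E v g <> 0%R); last first.
    have g0 : zero g by move=> v; apply: contrapT => nz; apply: z; exists v.
    have gV : untwist g^-1 = (untwist g)^-1.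
      apply/esym/mulg1_eq; rewrite -(flip0 (untwist g^-1)) -(sgn_id g0).
      by rewrite -untwistM mulgV untwist1.
    have gV0 : zero g^-1.
      move=> v; have := EM0 g g^-1 v g0.
      by rewrite mulgV /E untwist1 expo1 -/(E v g) g0 add0r => <-.
    have [||gP] := PV (untwist g); first by move/untwist_eq1.
      by left; right.
    by right; right; rewrite gV.
  (* Only letters of a word for [g] can have a nonzero exponent sum, so a last one exists among
     finitely many. *)
  have [t [tz tmax]] : exists t, E t g <> 0%R /\ above t g.
    pose s := [seq l.1 | l <- tau arr (fun=> false) (repr g)].
    have sE v : E v g <> 0%R -> v \in s.
      move=> nz0; apply: contrapT => /negP vs; apply: nz0.
      by rewrite /E /untwist -syl_eval_wordg expo_notin // -map_comp.
    suff : exists t, E t g <> 0%R /\ forall v, v \in s -> lt t v -> E v g = 0%R.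
      move=> [t [tz tmax]]; exists t; split=> // v tv; apply: contrapT => vz.
      exact/vz/tmax/tv/sE.
    have [v0 v0z] := nz; elim: (s) => [|x s' [t [tz tmax]]]; first by exists v0.
    have [[xz tx]|ntx] := pselect (E x g <> 0%R /\ lt t x).
      exists x; split=> // v; rewrite inE => /orP[/eqP -> /lt_irr //|vs xv].
      by apply: tmax => //; apply: lt_tr tx xv.
    exists t; split=> // v; rewrite inE => /orP[/eqP -> tx|]; last exact: tmax.
    by apply: contrapT => xz; apply: ntx.
  have gV v : t = v \/ lt t v -> E v g^-1 = (- E v g)%R.
    move=> tv; have := EM g g^-1 t v tmax tv.
    by rewrite mulgV {1}/E untwist1 expo1 => /esym/eqP; rewrite addrC addr_eq0 => /eqP.
  have /orP[tneg|tpos] : (E t g < 0)%R || (0 < E t g)%R by rewrite -neq_lt; apply/eqP.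
    right; left; exists t; split; first by rewrite gV ?oppr_gt0 //; left.
    by move=> v tv; rewrite gV ?tmax ?oppr0 //; right.
  by left; left; exists t.
Qed.

End Cocycle.

Local Close Scope ring_scope.

Theorem theorem1p5 (G : mixedGraph) :
  (torsion_free (TRAAG G) <->
     ~ (exists (n : nat) (e : 'I_n.+1 -> oriented G),
          oriented_cycle e /\ supported_on_complete e)) /\
  (left_orderable (TRAAG G) <->
     ~ (exists (n : nat) (e : 'I_n.+1 -> oriented G),
          oriented_cycle e)) /\
  (bi_orderable (TRAAG G) <-> oriented G = set0).
Proof.
split; last split; split.
- exact: clique_cycle_torsion.
- exact: traag_torsion_free.
- exact: left_orderable_acyclic.
- exact: acyclic_left_orderable.
- exact: bi_orderable_unoriented.
- exact: unoriented_bi_orderable.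
Qed.
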